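(* Let $X$ be a dendrite and let $f\colon X\to X$ be a continuous map. Then the following are equivalent: (e) there is no $f$-expanding arc in $X$; (g) the set $\mathrm{Per}(f)$ is connected.
   Context: $\mathbb N=\{1,2,3,\dots\}$; $f^n$ denotes the $n$-fold iterate of $f$. A continuum is a (nonempty) compact connected metric space. A dendrite is a locally connected continuum that contains no simple closed curve (no subspace homeomorphic to the unit circle). An arc is a space homeomorphic to $[0,1]$. An arc $A\subseteq X$ is $f$-expanding if there is $n\in\mathbb N$ with $A\subsetneq f^n[A]$. $\mathrm{Per}(f)=\{x\in X: f^n(x)=x\text{ for some }n\in\mathbb N\}$. *)

(* Defs.v *)
From HB Require Import structures.
From mathcomp Require Import all_boot all_order all_algebra.
From mathcomp Require Import all_classical all_reals all_analysis.

Set Implicit Arguments.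
Unset Strict Implicit.
Unset Printing Implicit Defensive.

Import Order.TTheory GRing.Theory Num.Theory.
Import numFieldNormedType.Exports.

Local Open Scope classical_set_scope.
Local Open Scope ring_scope.

Definition homeomorphic (S T : topologicalType) : Prop :=
  exists (h : S -> T) (g : T -> S),
    [/\ cancel h g, cancel g h, continuous h & continuous g].

(* [set_type A] is A as a type, with the topology induced by the ambient space
   (unlike [subspace A], which keeps the points outside A as isolated points). *)
Definition is_arc (R : realType) (X : topologicalType) (A : set X) : Prop :=
  homeomorphic (set_type A) (set_type (`[0, 1]%classic : set R)).

Definition unit_circle (R : realType) : set (R * R) :=
  [set p | p.1 ^+ 2 + p.2 ^+ 2 = 1].

Definition is_simple_closed_curve (R : realType) (X : topologicalType)
    (C : set X) : Prop :=
  homeomorphic (set_type C) (set_type (@unit_circle R)).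

Definition continuum (R : realType) (X : metricType R) : Prop :=
  [/\ [set: X] !=set0, compact [set: X] & connected [set: X]].

Definition locally_connected (X : topologicalType) : Prop :=
  forall (x : X) (U : set X), nbhs x U ->
    exists V : set X, [/\ open V, connected V, V x & V `<=` U].

Definition dendrite (R : realType) (X : metricType R) : Prop :=
  [/\ continuum X, locally_connected X
    & ~ exists C : set X, is_simple_closed_curve R C].

Definition expanding (X : Type) (f : X -> X) (A : set X) : Prop :=
  exists2 n : nat, (0 < n)%N & A `<` iter n f @` A.

Definition periodic_points (X : Type) (f : X -> X) : set X :=
  [set x | exists2 n : nat, (0 < n)%N & iter n f x = x].

(* Main.v *)
Require Import Defs.
From HB Require Import structures.
From mathcomp Require Import all_boot all_order all_algebra.
From mathcomp Require Import all_classical all_reals all_analysis.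
From mathcomp Require Import ring lra.

(* A locally connected continuum without simple closed curves is uniquely
   arcwise connected, and every connected set contains the arc between any two
   of its points.

   If no arc is expanding and x, y are fixed by g = f^n, then g maps the arc
   [x, y] onto itself; a point t of the arc with g(t) strictly between t and y
   would make the arc [x, t] expanding, and symmetrically. So all points of
   [x, y] are periodic.

   Conversely, let Per(f) be connected. If q is not periodic, then for every m
   there is a fixed point of f^m in the component of X \ {q} containing
   f^m(q), so the forward orbit of q stays in the component containing Per(f).
   If A is strictly contained in g(A), both endpoints of A are periodic:
   otherwise a backward orbit in A of a non-periodic endpoint is monotone and
   converges to a fixed point, which its first term separates from Per(f), absurd.
   Hence A consists of periodic points, some iterate g^k is injective on A and fixes its endpoints,
   and g^k(A) = A, a contradiction. *)

Set Implicit Arguments.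
Unset Strict Implicit.
Unset Printing Implicit Defensive.

Import Order.TTheory GRing.Theory Num.Theory.
Import numFieldNormedType.Exports.

Local Open Scope classical_set_scope.
Local Open Scope ring_scope.

(** * Paths in locally connected compact spaces *)

Section Paths.
Context {R : realType} {X : metricType R}.
Hypothesis lcX : locally_connected X.
Implicit Types (U V W : set X) (a b u v : X).

(* The closure condition makes successive refinements nested, so that cells of a
   refining sequence have a common limit point. *)
Definition link e V u v W :=
  [/\ open W, connected W, W u /\ W v, closure W `<=` V
    & forall w, W w -> W `<=` ball w e].

Lemma link_refl e V u : 0 < e -> open V -> V u -> exists W, link e V u u W.
Proof.
move=> e0 oV Vu.
have /nbhs_ballP[r /= r0 rV] : nbhs u V by exact: open_nbhs_nbhs.
pose d := Num.min (r / 2) (e / 2).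
have d0 : 0 < d by rewrite lt_min !divr_gt0.
have [W [oW cW Wu Wd]] := lcX (nbhsx_ballx u d d0).
exists W; split => //.
- apply: subset_trans rV; apply: subset_trans (subset_closure_half r0).
  rewrite -closure_ballE; apply: closureS; apply: subset_trans Wd _.
  by apply: le_ball; rewrite ge_min lexx.
- move=> w /Wd uw w' /Wd uw'; rewrite (splitr e).
  apply: (ball_triangle (y := u)).
    by apply: ball_sym; apply: le_ball uw; rewrite ge_min lexx orbT.
  by apply: le_ball uw'; rewrite ge_min lexx orbT.
Qed.

(** The sequence is infinite and stationary from [N] on, so that chains of different lengths can be
    padded to a common one. *)
Definition chain e V a b N (c : nat -> X) :=
  [/\ c 0 = a, (forall k, (N <= k)%N -> c k = b)
    & forall k, exists W, link e V (c k) (c k.+1) W].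

(** The points reached by chains from [a] form a relatively clopen subset of [V]: a small cell
    around a point of [V] links it to every point of the cell, in either direction. *)
Lemma chain_exists e V a b : 0 < e -> open V -> connected V -> V a -> V b ->
  exists N c, chain e V a b N c.
Proof.
move=> e0 oV cV Va Vb.
pose S := [set b | V b /\ exists N c, chain e V a b N c].
suff SV : S = V by have [] : S b by rewrite SV.
have ext u v W : S u -> link e V u v W -> S v.
  move=> [Vu [N [c [c0 cN cE]]]] uvW; have [oW cW [Wu Wv] clW Wball] := uvW.
  have Vv : V v by apply: clW; exact: subset_closure.
  split => //; exists N.+1, (fun k => if (k <= N)%N then c k else v); split.
  - by rewrite leq0n.
  - by move=> k; rewrite ltnNge => /negbTE ->.
  - move=> k; case: (ltngtP k N) => [kN|kN|->].
    + exact: cE.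
    + exact: link_refl.
    + by rewrite cN//; exists W.
have linkC u v W : link e V u v W -> link e V v u W.
  by move=> [? ? [? ?] ? ?]; split.
apply: cV.
- exists a; split => //; exists 0%N, (fun=> a); split => // k.
  exact: link_refl.
- exists (\bigcup_(W in [set W | open W /\ W `<=` S]) W).
    by apply: bigcup_open => W [].
  apply/seteqP; split => [z Sz|z [Vz [W [_]]]]; last exact.
  have Vz := Sz.1; split => //; have [W zW] := link_refl e0 oV Vz.
  have [oW cW [Wz _] clW Wball] := zW; exists W => //; split => // w Ww.
  by apply: (ext z w W) => //; split.
- exists (closure S); first exact: closed_closure.
  apply/seteqP; split => [z Sz|z [Vz clz]].
    by split; [exact: Sz.1|exact: subset_closure].
  have [W zW] := link_refl e0 oV Vz.
  have [oW cW [Wz _] clW Wball] := zW.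
  have [w [Sw Ww]] := clz W (open_nbhs_nbhs (conj oW Wz)).
  by apply: (ext w z W) => //; split.
Qed.

(* The bound [k <= M] is inclusive: the parameter [t = 1] falls in the cell [M]. *)
Definition level e x y M (c : nat -> X) (Ws : nat -> set X) :=
  [/\ (0 < M)%N, c 0 = x, c M = y
    & forall k, (k <= M)%N -> link e setT (c k) (c k.+1) (Ws k)].

(** Each cell [Ws k] is open and connected, so a finer chain inside it joins its two marked points;
    padding all chains to one length [N] puts the fine cell [k] inside the coarse cell [k %/ N]. *)
Lemma level_refine e e' x y M c Ws : 0 < e' -> level e x y M c Ws ->
  exists N c' Ws', [/\ (0 < N)%N, level e' x y (M * N) c' Ws'
    & forall k, (k <= M * N)%N -> closure (Ws' k) `<=` Ws (k %/ N)%N].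
Proof.
move=> e'0 [M0 c0 cM cW].
have ch k : exists q : nat * (nat -> X),
    (k <= M)%N -> chain e' (Ws k) (c k) (c k.+1) q.1 q.2.
  have [kM|kM] := boolP (k <= M)%N; last by exists (0%N, c).
  have [oW conW [Wk Wk1] _ _] := cW _ kM.
  have [N [d dP]] := chain_exists e'0 oW conW Wk Wk1.
  by exists (N, d).
have {ch} [q qP] := choice ch.
(* [N >= 2], so that the cell [M * N] is not the last piece of its block: the
   next block is not controlled. *)
pose N := (\max_(k < M.+1) (q k).1)%N.+2.
have qN k : (k <= M)%N -> ((q k).1 <= N)%N.
  move=> kM; do 2 apply: leqW.
  exact: (@leq_bigmax _ (fun k : 'I_M.+1 => (q k).1) (Ordinal (kM : (k < M.+1)%N))).
pose c' k := (q (k %/ N)%N).2 (k %% N)%N.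
have N0 : (0 < N)%N by [].
have c'S k : (k <= M * N)%N -> c' k.+1 = (q (k %/ N)%N).2 (k %% N).+1.
  move=> kMN; have kM : (k %/ N <= M)%N by rewrite -(mulnK M N0) leq_div2r.
  rewrite /c'; have := divn_eq k N; have := ltn_pmod k N0.
  set i := (k %/ N)%N in kM *; set j := (k %% N)%N => jN kE.
  have [jN1|] := ltnP j.+1 N.
    rewrite {1 2}kE -addnS divnMDl// (divn_small jN1) addn0.
    by rewrite modnMDl (modn_small jN1).
  move=> jN1; have {jN1} jE : j.+1 = N by apply/eqP; rewrite eqn_leq jN.
  have -> : (k.+1 = i.+1 * N)%N by rewrite kE -addnS jE mulSn addnC.
  rewrite mulnK// modnMl.
  have [_ qE _] := qP _ kM; rewrite jE qE; last exact: qN.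
  have [iM|Mi] := ltnP i M; first by have [-> _ _] := qP _ iM.
  have iE : i = M by apply/eqP; rewrite eqn_leq kM.
  move: kMN; rewrite kE iE -{2}[(M * N)%N]addn0 leq_add2l leqn0 => /eqP j0.
  by move: jE; rewrite j0.
have li k : exists W', (k <= M * N)%N -> link e' (Ws (k %/ N)%N) (c' k) (c' k.+1) W'.
  have [kMN|] := boolP (k <= M * N)%N; last by exists setT.
  have kM : (k %/ N <= M)%N by rewrite -(mulnK M N0) leq_div2r.
  have [_ _ /(_ (k %% N)%N)[W' W'P]] := qP _ kM.
  by exists W' => _; rewrite c'S.
have {li} [Ws' Ws'P] := choice li.
exists N, c', Ws'; split => //; last by move=> k /Ws'P[].
split => //.
- by rewrite muln_gt0 M0.
- by rewrite /c' div0n mod0n; have [->] := qP 0%N (leq0n _).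
- by rewrite /c' mulnK// modnMl; have [->] := qP M (leqnn _).
- by move=> k kMN; have [? ? ? _ ?] := Ws'P _ kMN; split.
Qed.
Lemma closure_ball_center e W u p : 0 < e ->
  (forall w, W w -> W `<=` ball w e) -> W u -> closure W p -> ball u (e * 2) p.
Proof.
move=> e0 Wball Wu clp; have [w [Ww pw]] := clp _ (nbhsx_ballx p e e0).
rewrite mulr_natr mulr2n; apply: (ball_triangle (y := w)).
  exact: (Wball u Wu).
exact: ball_sym.
Qed.

(** Precomposing with this retraction onto [[0, 1]] extends paths to all of [R], so that continuity
    needs no subspace topology. *)
Definition clamp (t : R) := Num.max 0 (Num.min t 1).

Lemma clamp_itv t : 0 <= clamp t <= 1.
Proof. by rewrite /clamp le_max lexx ge_max ler01 ge_min lexx orbT. Qed.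

Lemma clamp_id t : 0 <= t <= 1 -> clamp t = t.
Proof. by move=> /andP[t0 t1]; rewrite /clamp min_l// max_r. Qed.

Lemma clamp_lip s t : `|clamp s - clamp t| <= `|s - t|.
Proof.
wlog ts : s t / t <= s.
  by move=> H; have [/H//|/ltW/H] := leP t s; rewrite distrC [X in _ <= X]distrC.
have m01 : Num.max 0 1 = 1 :> R by rewrite max_r.
rewrite (ger0_norm (_ : 0 <= s - t)) ?subr_ge0// /clamp.
case: (leP s 1) => s1; case: (leP t 1) => t1; rewrite ?m01;
  try case: (leP 0 s) => s0; try case: (leP 0 t) => t0;
  rewrite ler_norml; apply/andP; split; lra.
Qed.

(** This makes the cells that contain one given parameter nested across successive levels. *)
Lemma truncn_mul (t : R) (N : nat) : 0 <= t -> (0 < N)%N ->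
  (Num.truncn (t * N%:R) %/ N)%N = Num.truncn t.
Proof.
move=> t0 N0; symmetry; apply: truncn_def.
have tN0 : 0 <= t * N%:R by rewrite mulr_ge0.
have /andP[] := truncn_itv tN0.
set k := Num.truncn (t * N%:R) => k1 k2.
have N0' : 0 < N%:R :> R by rewrite ltr0n.
apply/andP; split.
  rewrite -(ler_pM2r N0') -natrM; apply: le_trans k1.
  by rewrite ler_nat leq_trunc_div.
rewrite -(ltr_pM2r N0') -natrM; apply: lt_le_trans k2 _.
by rewrite ler_nat ltn_ceil.
Qed.

(** Infinitely many refinements give each parameter a nested sequence of cells whose diameters tend
    to 0; the path sends the parameter to their common limit point. *)
Lemma path_exists U x y : compact [set: X] ->
  open U -> connected U -> U x -> U y ->
  exists g : R -> X, [/\ continuous g, g 0 = x, g 1 = y & forall t, U (g t)].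
Proof.
move=> cptX oU cU Ux Uy.
pose T := (nat * nat * (nat -> X) * (nat -> set X))%type.
pose ep n : R := n.+1%:R^-1.
have ep0 n : 0 < ep n by rewrite invr_gt0 ltr0n.
pose P (p : T) := level (ep p.1.1.1) x y p.1.1.2 p.1.2 p.2.
pose Q (p q : T) := q.1.1.1 = p.1.1.1.+1 /\
  exists N, [/\ (0 < N)%N, q.1.1.2 = (p.1.1.2 * N)%N &
    forall k, (k <= q.1.1.2)%N -> closure (q.2 k) `<=` p.2 (k %/ N)%N].
have [p0 [p00 Pp0 p0U]] : exists p0 : T, [/\ p0.1.1.1 = 0%N, P p0 &
    forall k, (k <= p0.1.1.2)%N -> closure (p0.2 k) `<=` U].
  have [N [c [c0 cN cE]]] := chain_exists (ep0 0%N) oU cU Ux Uy.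
  have [Ws WsP] := choice cE.
  exists (0%N, N.+1, c, Ws); split => //=; last by move=> k _; case: (WsP k).
  split => //=; first exact: cN.
  by move=> k _; have [? ? ? _ ?] := WsP k; split.
have nxt p : exists q, P p -> P q /\ Q p q.
  have [Pp|] := pselect (P p); last by exists p.
  have [N [c' [Ws' [N0 L' clW]]]] := level_refine (ep0 p.1.1.1.+1) Pp.
  exists (p.1.1.1.+1, (p.1.1.2 * N)%N, c', Ws') => _; split => //.
  by split => //; exists N.
have {nxt} [F FP] := choice nxt.
pose s n := iter n F p0.
have Ps n : P (s n) by elim: n => // n /FP[].
have Qs n : Q (s n) (s n.+1) by have [] := FP _ (Ps n).
have sn n : (s n).1.1.1 = n by elim: n => // n IH; rewrite (Qs n).1 IH.
pose M n := (s n).1.1.2; pose c n := (s n).1.2; pose Ws n := (s n).2.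
have sP n : level (ep n) x y (M n) (c n) (Ws n) by have := Ps n; rewrite /P sn.
have QM n : exists N, [/\ (0 < N)%N, M n.+1 = (M n * N)%N &
    forall k, (k <= M n.+1)%N -> closure (Ws n.+1 k) `<=` Ws n (k %/ N)%N].
  by have [_] := Qs n.
have {p0U Qs} M0U k : (k <= M 0)%N -> closure (Ws 0 k) `<=` U by exact: p0U.
clearbody M c Ws; clear F FP s Ps sn p0 p00 Pp0 P Q T.
pose K n (t : R) := Num.truncn (t * (M n)%:R).
have KM n t : 0 <= t <= 1 -> (K n t <= M n)%N.
  move=> /andP[t0 t1]; rewrite truncn_le_nat; apply: (@le_lt_trans _ _ (M n)%:R).
    by rewrite ler_piMl.
  by rewrite ltr_nat.
have nest n t : 0 <= t <= 1 -> closure (Ws n.+1 (K n.+1 t)) `<=` Ws n (K n t).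
  move=> t01; have [N [N0 ME cl]] := QM n.
  have /cl := KM n.+1 t t01; rewrite {2}/K ME natrM mulrA truncn_mul//.
  by rewrite mulr_ge0//; case/andP: t01.
have Wc n k : (k <= M n)%N -> Ws n k (c n k) /\ Ws n k (c n k.+1).
  by move=> kM; have [_ _ _ /(_ _ kM)[]] := sP n.
have ex t : exists p, 0 <= t <= 1 -> forall n, closure (Ws n (K n t)) p.
  have [t01|t01] := boolP (0 <= t <= 1); last by exists x.
  (* By compactness the marked points of the cells of [t] cluster at some [p]; nestedness puts [p]
     in the closure of every cell. *)
  have [p [_ clp]] := cptX ((fun n => c n (K n t)) @ \oo) _ filterT.
  exists p => _ n B Bp; apply: clp => //.
  exists n => // m /= nm; have : Ws m (K m t) (c m (K m t)).
    by have [] := Wc m _ (KM m t t01).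
  move: (c m _) => w; elim: m nm => [|m IH]; first by rewrite leqn0 => /eqP ->.
  rewrite leq_eqVlt => /orP[/eqP -> //|]; rewrite ltnS => /IH{}IH ?.
  by apply/IH/nest => //; exact: subset_closure.
have {ex} [h hP] := choice ex.
have hball n t k : 0 <= t <= 1 -> (k = K n t \/ k = (K n t).+1) ->
    ball (c n k) (ep n * 2) (h t).
  move=> t01 kE; have [_ _ _ /(_ _ (KM n t t01))[_ _ [W1 W2] _ Wb]] := sP n.
  apply: (closure_ball_center (ep0 n) Wb); last exact: hP.
  by case: kE => ->.
(* Parameters closer than [1 / M n] fall into the same or adjacent cells, which share a marked
   point; each of the two images is within [ep n * 2] of it. *)
have near s t n : 0 <= s <= 1 -> 0 <= t <= 1 -> s <= t ->
    `|t - s| * (M n)%:R < 1 -> ball (h s) (ep n * 4) (h t).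
  move=> s01 t01 st stM.
  have Kst : (K n s <= K n t <= (K n s).+1)%N.
    have /andP[s0 _] := s01.
    rewrite le_truncn ?ler_wpM2r ?ler0n//= truncn_le_nat.
    have : s * (M n)%:R < (K n s).+1%:R by exact: truncnS_gt.
    by move: stM; rewrite ger0_norm ?subr_ge0// -!natr1; lra.
  have [k ks kt] : exists2 k, (k = K n s \/ k = (K n s).+1) &
      (k = K n t \/ k = (K n t).+1).
    move: Kst; rewrite andbC leq_eqVlt ltnS => /andP[/orP[/eqP E|E] E'].
      by exists (K n s).+1; [right|left].
    by exists (K n s); left => //; apply/eqP; rewrite eqn_leq E E'.
  have -> : ep n * 4 = ep n * 2 + ep n * 2 by rewrite -mulrDr -natrD.
  by apply: (ball_triangle (y := c n k)); [apply: ball_sym|]; exact: hball.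
have hsmall s t n : 0 <= s <= 1 -> 0 <= t <= 1 ->
    `|t - s| * (M n)%:R < 1 -> ball (h s) (ep n * 4) (h t).
  move=> s01 t01; have [st|/ltW ts] := leP s t; first exact: near.
  by rewrite distrC => ?; apply: ball_sym; exact: near.
have small (e : R) : 0 < e -> exists n, ep n * 4 < e.
  move=> e0; exists (Num.truncn (4 / e)).
  by rewrite mulrC ltr_pdivrMr ?ltr0n// mulrC -ltr_pdivrMr// truncnS_gt.
have h0 p t : 0 <= t <= 1 -> (forall n, c n (K n t) = p) -> h t = p.
  move=> t01 cp; apply/esym/(@metric_hausdorff _ X) => A B nA nB.
  have /nbhs_ballP[e /= e0 eA] := nA.
  have [n ne] := small e e0.
  exists (h t); split; last exact: nbhs_singleton.
  apply: eA; apply: le_ball (ltW ne) _ _; rewrite -(cp n).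
  apply: (@le_ball _ _ _ (ep n * 2)); first by rewrite ler_pM2l// ler_nat.
  by apply: hball => //; left.
exists (h \o clamp); split.
- move=> t; apply/cvg_ballP => e e0.
  have [n ne] := small e e0.
  have M0 : 0 < (M n)%:R :> R by rewrite ltr0n; have [] := sP n.
  apply/nbhs_ballP; exists (M n)%:R^-1 => /=; first by rewrite invr_gt0.
  move=> u tu; apply: le_ball (ltW ne) _ _.
  apply: hsmall; rewrite ?clamp_itv//.
  rewrite -ltr_pdivlMr// mul1r distrC; exact: le_lt_trans (clamp_lip _ _) tu.
- rewrite /= clamp_id ?lexx ?ler01//; apply: h0; rewrite ?lexx ?ler01// => n.
  by rewrite /K mul0r truncn0; have [_ ->] := sP n.
- rewrite /= clamp_id ?lexx ?ler01//; apply: h0; rewrite ?lexx ?ler01// => n.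
  by rewrite /K mul1r natrK; have [_ _ ->] := sP n.
- move=> t; apply: (M0U _ (KM 0%N _ (clamp_itv t))); apply: hP; exact: clamp_itv.
Qed.
End Paths.

(** * From paths to arcs *)

Section RealLemmas.
Context {R : realType}.
Implicit Types (s t u : R).

Lemma last_point (C : set R) c m : closed C -> C c -> c <= m ->
  exists s, [/\ C s, c <= s <= m & forall u, s < u -> u <= m -> ~ C u].
Proof.
move=> clC Cc cm.
have cpt : compact (C `&` `[c, m]).
  by rewrite setIC; apply: compact_closedI => //; exact: segment_compact.
have ne : (C `&` `[c, m]) !=set0 by exists c; split => //=; rewrite in_itv/= lexx.
have [s] := compact_EVT_max ne cpt (@continuous_subspaceT _ _ _ idfun (fun=> cvg_id)).
rewrite inE/= in_itv/= => -[Cs cs] smax; exists s; split => // u su um Cu.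
have : u \in C `&` `[c, m].
  rewrite inE; split => //=; rewrite in_itv/= um andbT.
  by apply: le_trans (ltW su); case/andP: cs.
by move=> /smax; rewrite leNgt su.
Qed.

Lemma first_point (C : set R) c m : closed C -> C c -> m <= c ->
  exists s, [/\ C s, m <= s <= c & forall u, u < s -> m <= u -> ~ C u].
Proof.
move=> clC Cc mc.
have clN : closed (-%R @^-1` C) by apply: closed_comp => // x _; exact: opp_continuous.
have [||s [Cs /andP[cs sm] sl]] := @last_point (-%R @^-1` C) (- c) (- m) clN.
- by rewrite /= opprK.
- by rewrite lerN2.
exists (- s); split => //; first by apply/andP; split; lra.
move=> u us mu Cu; apply: (sl (- u)); [lra|lra|].
by rewrite /= opprK.
Qed.

(** Moving the end of the interval changes the maximum only through values of [phi] near that end,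
    whence continuity. *)
Lemma running_max (phi : R -> R) : continuous phi ->
  exists m : R -> R, [/\ continuous m,
    forall t u, 0 <= t <= 1 -> 0 <= u <= t -> phi u <= m t
    & forall t, 0 <= t <= 1 -> exists2 u, 0 <= u <= t & m t = phi u].
Proof.
move=> cphi.
have ex t : exists c, 0 <= c <= clamp t /\
    forall u, 0 <= u <= clamp t -> phi u <= phi c.
  have [c] := EVT_max (proj1 (andP (clamp_itv t))) (continuous_subspaceT cphi).
  rewrite in_itv/= => ct cmax; exists c; split => // u ut; exact: cmax.
have {ex} [c cP] := choice ex; exists (phi \o c); split.
- move=> t; apply/cvgrPdist_lt => e e0.
  have e20 : 0 < e / 2 by rewrite divr_gt0.
  have /cvgrPdist_lt/(_ _ e20)/nbhs_ballP[d /= d0 dP] := cphi (clamp t).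
  apply/nbhs_ballP; exists d => //= s ts.
  have Tsd : `|clamp t - clamp s| < d by exact: le_lt_trans (clamp_lip t s) ts.
  have near v : `|clamp t - v| < d -> `|phi (clamp t) - phi v| < e / 2.
    by move=> vd; exact: dP.
  have [cs smax] := cP s; have [ct tmax] := cP t.
  have := near _ Tsd; move: Tsd near; have := clamp_itv s; have := clamp_itv t.
  move: (clamp s) (clamp t) cs smax ct tmax => S T.
  move=> /andP[cs0 csS] smax /andP[ct0 ctT] tmax /andP[T0 T1] /andP[S0 S1] TS nr.
  have TT := tmax T; have SS := smax S.
  rewrite T0 lexx in TT; rewrite S0 lexx in SS.
  have {}TT := TT isT; have {}SS := SS isT.
  move=> nS.
  have H1 : phi (c s) < phi (c t) + e.
    have [csT|csT] := leP (c s) T.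
      by have := tmax (c s); rewrite cs0 csT => /(_ isT); lra.
    have : `|T - c s| < d by move: TS; rewrite !ltr_norml; lra.
    by move=> /nr; rewrite ltr_norml; lra.
  have H2 : phi (c t) < phi (c s) + e.
    have [ctS|ctS] := leP (c t) S.
      by have := smax (c t); rewrite ct0 ctS => /(_ isT); lra.
    have : `|T - c t| < d by move: TS; rewrite !ltr_norml; lra.
    by move=> /nr; move: nS; rewrite !ltr_norml; lra.
  by rewrite ltr_norml; lra.
- move=> t u t01 ut; have [_] := cP t; rewrite clamp_id// => /(_ u); exact.
- by move=> t t01; have [+ _] := cP t; rewrite clamp_id// => ?; exists (c t).
Qed.

(** The series of the [w n / 2 ^ n.+1] converges uniformly, so the sum is continuous; it keeps weak
    inequalities and is strict as soon as one term is. *)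
Lemma weighted_sum (w : nat -> R -> R) :
  (forall n, continuous (w n)) -> (forall n t, 0 <= w n t <= 1) ->
  exists W : R -> R, continuous W /\
    forall s t, (forall n, w n s <= w n t) ->
      W s <= W t /\ ((exists n, w n s < w n t) -> W s < W t).
Proof.
move=> cw w01.
pose S N t := \sum_(0 <= n < N) w n t / 2 ^+ n.+1.
have p2 n : 0 < 2 ^- n.+1 :> R by rewrite invr_gt0 exprn_gt0.
have SS n t : S n.+1 t = S n t + w n t / 2 ^+ n.+1 by rewrite /S big_nat_recr.
have Smono t : {homo S^~ t : n m / (n <= m)%N >-> n <= m}.
  apply: homo_leq => //; first exact: le_trans.
  move=> n; rewrite SS lerDl mulr_ge0 ?(ltW (p2 _))//.
  by case/andP: (w01 n t).
have Stail t n m : S (n + m)%N t <= S n t + (2 ^- n - 2 ^- (n + m)).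
  elim: m => [|m IH]; first by rewrite addn0 subrr addr0.
  have : w (n + m)%N t / 2 ^+ (n + m).+1 <= 2 ^- (n + m).+1.
    by rewrite ler_piMl ?(ltW (p2 _))//; case/andP: (w01 (n + m)%N t).
  have : 2 ^- (n + m) = 2 ^- (n + m).+1 + 2 ^- (n + m).+1 :> R.
    by rewrite exprS invfM; field; rewrite expf_neq0.
  by rewrite addnS SS; lra.
have p20 n : 0 < 2 ^- n :> R by rewrite invr_gt0 exprn_gt0.
have Sub t n m : S m t <= S n t + 2 ^- n.
  have [mn|nm] := leqP m n.
    by apply: (le_trans (Smono t _ _ mn)); rewrite lerDl ltW.
  have := Stail t n (m - n)%N; rewrite (subnKC (ltnW nm)).
  by have := p20 m; lra.
have Scvg t : cvgn (S^~ t).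
  apply: nondecreasing_is_cvgn => //; exists (S 0%N t + 2 ^- 0) => _ [m _ <-].
  exact: Sub.
pose W t := limn (S^~ t).
have SW n t : S n t <= W t by exact: nondecreasing_cvgn_le.
have WS n t : W t <= S n t + 2 ^- n by apply: limr_le => //; near=> m; exact: Sub.
have cS n : continuous (S n).
  elim: n => [|n IH].
    rewrite (_ : S 0%N = cst 0); first by move=> t; exact: cvg_cst.
    by apply/funext => t; rewrite /S big_geq.
  rewrite (_ : S n.+1 = fun t => S n t + w n t / 2 ^+ n.+1).
    by move=> t; apply: cvgD; [exact: IH|apply: cvgMr_tmp; exact: cw].
  by apply/funext => t; rewrite SS.
exists W; split.
  move=> t; apply/cvgrPdist_lt => e e0.
  have e30 : 0 < e / 3 by rewrite divr_gt0.
  have [n ne] : exists n, 2 ^- n < e / 3 :> R.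
    have [n _ /(_ n (leqnn n))] := near_infty_natSinv_expn_lt (PosNum e30).
    by rewrite /= div1r => ne; exists n.
  have /cvgrPdist_lt/(_ _ e30) := cS n t; apply: filterS => s.
  have := SW n s; have := SW n t; have := WS n s; have := WS n t.
  by rewrite !ltr_norml; lra.
move=> s t wst.
have dmono n : S n s <= S n t.
  by apply: ler_sum_nat => k _; rewrite ler_pM2r.
split; first by apply: ler_lim => //; near=> n.
(* The gain [d] of the [n]-th term persists in all later partial sums, hence in the limit. *)
move=> [n wn]; pose d := w n t / 2 ^+ n.+1 - w n s / 2 ^+ n.+1.
have d0 : 0 < d by rewrite /d -mulrBl mulr_gt0// subr_gt0.
suff : W s + d <= W t by lra.
have -> : W s + d = limn (fun m => S m s + d).
  apply/esym/cvg_lim => //; apply: cvgD; last exact: cvg_cst.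
  exact: Scvg.
apply: ler_lim => //.
  by apply: is_cvgD => //; exact: is_cvg_cst.
exists n.+1 => // m /= nm; rewrite -(subnKC nm); elim: (m - n.+1)%N => [|k IH].
  by rewrite addn0 !SS /d; have := dmono n; lra.
rewrite addnS (SS (n.+1 + k)%N s) (SS (n.+1 + k)%N t) addrAC.
by apply: lerD => //; rewrite ler_pM2r.
Unshelve. all: end_near.
Qed.
End RealLemmas.

(** * Erasing the loops of a path *)

Section Prune.
Context {R : realType} {X : metricType R}.
Implicit Types (g h : R -> X) (U : set R).

(* An open set [U] of parameters can be cut out of the path [g] when [g] takes
   the same value at both ends of each component of [U]. A maximal such [U]
   erases all loops of [g]. *)
Definition collapsible g U := [/\ open U, U `<=` `]0, 1[
  & forall s t, s < t -> ~ U s -> ~ U t -> (forall u, s < u -> u < t -> U u) ->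
      g s = g t].

(** Chain condition for Zorn's lemma. By compactness, a single member of the chain covers a gap []s,
    t[] of the union up to an arbitrarily small margin; [g] agrees at the two ends of that member's
    gap, which are close to [s] and [t]. *)
Lemma collapsible_bigcup g (F : set (set R)) : continuous g ->
  F `<=` collapsible g -> total_on F subset ->
  collapsible g (\bigcup_(U in F) U).
Proof.
move=> cg FP Ftot; split.
- by apply: bigcup_open => U /FP[].
- by move=> t [U /FP[_ U01 _] /U01].
move=> s t st Us Ut gap; apply: (@metric_hausdorff _ X) => A B nA nB.
have [d d0 dAB] : exists2 d, 0 < d & forall u v,
    `|s - u| < d -> `|t - v| < d -> A (g u) /\ B (g v).
  have /nbhs_ballP[d1 /= d10 d1A] := cg s _ nA.
  have /nbhs_ballP[d2 /= d20 d2B] := cg t _ nB.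
  exists (Num.min d1 d2); first by rewrite lt_min d10.
  move=> u v; rewrite !lt_min => /andP[su _] /andP[_ tv].
  by split; [exact: d1A|exact: d2B].
pose e := Num.min (d / 2) ((t - s) / 4).
have [e0 [ed et]] : 0 < e /\ e < d /\ e <= (t - s) / 4.
  rewrite lt_min !divr_gt0 ?subr_gt0//; split => //; split.
    by rewrite gt_min ltr_pdivrMr// ltr_pMr// ltr1n.
  by rewrite ge_min lexx orbT.
clearbody e.
have cpt := @segment_compact R (s + e) (t - e).
have [m mE] : exists m, m = (s + t) / 2 by eexists.
have [U1 FU1 _] : (\bigcup_(U in F) U) m by apply: gap; lra.
(* Properties that hold eventually along the chain: with this filter, the near-covering form of
   compactness extracts one member [U0] containing the whole segment. *)
pose G : set_system (set R) :=
  [set Q | exists2 U0, F U0 & forall U, F U -> U0 `<=` U -> Q U].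
have FG : Filter G.
  split.
  - by exists U1.
  - move=> P Q [UP FUP PP] [UQ FUQ QQ].
    have [PQ|QP] := Ftot _ _ FUP FUQ.
      exists UQ => // U FU QU; split; last exact: QQ.
      by apply: PP => //; exact: subset_trans QU.
    exists UP => // U FU QU; split; first exact: PP.
    by apply: QQ => //; exact: subset_trans QU.
  - by move=> P Q PQ [U0 FU0 PP]; exists U0 => // U FU U0U; apply/PQ/PP.
have [|U0 FU0 /(_ _ FU0 (@subset_refl _ U0)) seU] :=
    (compact_near_coveringP _).1 cpt _ G (fun U => U) FG.
  move=> u; rewrite /= in_itv/= => /andP[u1 u2].
  have [U FU Uu] : (\bigcup_(U in F) U) u by apply: gap; lra.
  have [oU _ _] := FP _ FU.
  exists (U, [set V | F V /\ U `<=` V]).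
    split; last by exists U => // V FV UV.
    exact: open_nbhs_nbhs.
  by move=> [x V] [/= Ux [_]]; exact.
have [oU0 _ gapU0] := FP _ FU0.
have clU0 : closed (~` U0) by exact: open_closedC.
have nU0 v : ~ (\bigcup_(U in F) U) v -> (~` U0) v.
  by move=> nv U0v; apply: nv; exists U0.
have seU' u : s + e <= u -> u <= t - e -> U0 u.
  by move=> u1 u2; apply: seU; rewrite /= in_itv/= u1.
have [|s' [Us' /andP[ss' sm'] sl]] := last_point clU0 (nU0 _ Us) (m := m).
  by lra.
have [|t' [Ut' /andP[tm' tt'] tl]] := first_point clU0 (nU0 _ Ut) (m := m).
  by lra.
have s'e : s' < s + e.
  by rewrite ltNge; apply/negP => ?; apply: Us'; apply: seU' => //; lra.
have t'e : t - e < t'.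
  by rewrite ltNge; apply/negP => ?; apply: Ut'; apply: seU' => //; lra.
have gst : g s' = g t'.
  apply: gapU0 => //; first by lra.
  move=> u s'u ut'; apply: contrapT => nU0u.
  have [um|mu] := leP u m; first exact: (sl u).
  by apply: (tl u) => //; exact: ltW.
have [Ags Bgt] : A (g s') /\ B (g t').
  by apply: dAB; rewrite ltr_norml; apply/andP; split; lra.
by exists (g s'); split => //; rewrite gst.
Qed.

(** If [g s = g t] with [s] and [t] outside a maximal [U], then adding []s, t[] to [U] keeps it
    collapsible, so maximality applies. *)
Lemma collapsible_maximal g : continuous g -> exists U, collapsible g U /\
  forall s t, 0 <= s -> s < t -> t <= 1 -> ~ U s -> ~ U t -> g s = g t ->
    forall u, s < u -> u < t -> U u.
Proof.
move=> cg.
have [U [[oU U01 Ugap] Umax]] := Zorn_bigcup (P := collapsible g)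
  (fun F FP Ftot => collapsible_bigcup cg FP Ftot).
exists U; split => // s t s0 st t1 Us Ut gst u su ut; apply: contrapT => Uu.
pose B := U `|` `]s, t[.
have stB v : s < v -> v < t -> B v by move=> ? ?; right; rewrite /= in_itv/=; apply/andP.
apply: (Umax B).
  split; first by move=> v Uv; left.
  by move=> /(_ u (stB u su ut)).
split.
- by apply: openU => //; exact: itv_open.
- move=> v [/U01//|]; rewrite /= !in_itv/= => /andP[sv vt].
  by rewrite (le_lt_trans s0 sv) (lt_le_trans vt t1).
move=> p q pq Bp Bq Bgap.
have Up : ~ U p by move=> ?; apply: Bp; left.
have Uq : ~ U q by move=> ?; apply: Bq; left.
have gapU p' q' : p <= p' -> p' <= q' -> q' <= q -> ~ U p' -> ~ U q' ->
    q' <= s \/ t <= p' -> g p' = g q'.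
  move=> pp'; rewrite le_eqVlt => /orP[/eqP -> //|p'q'] q'q Up' Uq' out.
  apply: Ugap => // v pv vq; have : B v.
    by apply: Bgap; [exact: le_lt_trans pv|exact: lt_le_trans q'q].
  case=> //; rewrite /= in_itv/= => /andP[sv vt].
  by case: out => ?; lra.
have [qs|sq] := leP q s; first by apply: gapU => //; [exact: ltW|left].
have [tp|pt] := leP t p; first by apply: gapU => //; [exact: ltW|right].
have ps : p <= s by rewrite leNgt; apply/negP => sp; apply: Bp; exact: stB.
have tq : t <= q by rewrite leNgt; apply/negP => qt; apply: Bq; exact: stB.
rewrite (gapU p s)//; last by left.
  by rewrite gst; apply: gapU => //; [lra|right].
by lra.
Qed.

(** [h] follows [g] on the parameters outside a maximal collapsible [U] and is frozen on its gaps.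
    Two survivors with equal values have no survivor between them, so the fibres of [h] in [[0, 1]]
    are intervals. *)
Lemma monotone_path g : continuous g -> exists h,
  [/\ continuous h, h 0 = g 0, h 1 = g 1,
    forall t, exists2 u, 0 <= u <= 1 & h t = g u
    & forall s u t, 0 <= s -> s <= u -> u <= t -> t <= 1 -> h s = h t ->
        h u = h s].
Proof.
move=> cg; have [U [[oU U01 Ugap] Umax]] := collapsible_maximal cg.
have clU : closed (~` U) by exact: open_closedC.
have U0 : ~ U 0 by move=> /U01; rewrite /= in_itv/= ltxx.
have U1 : ~ U 1 by move=> /U01; rewrite /= in_itv/= ltxx andbF.
have ex t : exists l, 0 <= t -> [/\ ~ U l, 0 <= l <= t &
    forall u, l < u -> u <= t -> U u].
  have [t0|t0] := leP 0 t; last by exists 0.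
  have [l [Ul lt lmax]] := last_point clU U0 t0.
  by exists l => _; split => // u lu ut; apply: contrapT; exact: lmax.
have {ex} [l lP] := choice ex.
have l_mono s t : 0 <= s -> s <= t -> l s <= l t.
  move=> s0 st; have t0 := le_trans s0 st.
  have [Us /andP[ls0 ls] _] := lP s s0; have [_ _ lt] := lP t t0.
  by rewrite leNgt; apply/negP => ?; apply: Us; apply: lt => //; exact: le_trans st.
(* [l t] is the last parameter before [t] that survives the cutting. *)
pose k t := g (l t).
(* For continuity: either nothing survives between [u] and [t], or [k u] is the value of [g] at the
   first survivor [r >= u], since [l u] and [r] coincide or bound a gap. *)
have near u t : 0 <= u -> u <= t -> k u = k t \/
    exists v w, [/\ u <= v <= t, u <= w <= t, k u = g v & k t = g w].
  move=> u0 ut; have t0 := le_trans u0 ut.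
  have [Ulu /andP[lu0 lu] lumax] := lP u u0.
  have [Ult /andP[lt0 lt] ltmax] := lP t t0.
  have [ltu|ult] := ltP (l t) u.
    left; rewrite /k; congr g; apply/eqP; rewrite eq_le l_mono//=.
    rewrite leNgt; apply/negP => lul; apply: Ult; apply: lumax => //; exact: ltW.
  right; have [r [Ur /andP[ur rl] rmin]] := first_point clU Ult ult.
  exists r, (l t); split; rewrite ?ur ?ult ?(le_trans rl)//.
  have := le_trans lu ur; rewrite le_eqVlt => /orP[/eqP lr|lr].
    by rewrite /k lr.
  apply: Ugap => // w lw wr; have [wu|uw] := leP w u; first exact: lumax.
  by apply: contrapT; apply: rmin => //; exact: ltW.
have clamp_ge0 t : 0 <= clamp t :> R by case/andP: (clamp_itv t).
exists (k \o clamp); split.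
- move=> t; apply/cvg_ballP => e e0.
  have e20 : 0 < e / 2 by rewrite divr_gt0.
  have /cvg_ballP/(_ _ e20)/nbhs_ballP[d /= d0 dP] := cg (clamp t).
  apply/nbhs_ballP; exists d => //= s ts.
  have Tsd : `|clamp t - clamp s| < d by exact: le_lt_trans (clamp_lip t s) ts.
  have bvw v w : `|clamp t - v| < d -> `|clamp t - w| < d ->
      ball (g v) e (g w).
    move=> vd wd; rewrite (splitr e); apply: (ball_triangle (y := g (clamp t))).
      by apply: ball_sym; exact: dP.
    exact: dP.
  have [st|ts'] := leP (clamp s) (clamp t).
    have [->|[v [w [v1 w1 -> ->]]]] := near _ _ (clamp_ge0 s) st.
      exact: ballxx.
    apply: bvw; move: Tsd; rewrite !ltr_norml => /andP[? ?]; apply/andP; split; lra.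
  have [->|[v [w [v1 w1 -> ->]]]] := near _ _ (clamp_ge0 t) (ltW ts').
    exact: ballxx.
  apply: bvw; move: Tsd; rewrite !ltr_norml => /andP[? ?]; apply/andP; split; lra.
- rewrite /= clamp_id ?lexx ?ler01// /k; have [_ + _] := lP 0 (lexx _).
  by move=> /le_anti <-.
- rewrite /= clamp_id ?lexx ?ler01// /k; have [_ /andP[l0 l1] lmax] := lP 1 ler01.
  move: l1; rewrite le_eqVlt => /orP[/eqP -> //|l1].
  by case: U1; apply: lmax.
- move=> t; exists (l (clamp t)) => //; have [_ /andP[-> ?] _] := lP _ (clamp_ge0 t).
  by apply: (@le_trans _ _ (clamp t)) => //; case/andP: (clamp_itv t).
move=> s u t s0 su ut t1; have u0 := le_trans s0 su; have t0 := le_trans u0 ut.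
rewrite /= !clamp_id; [|by lra..].
rewrite /k => gst.
have [Us /andP[ls0 ls] _] := lP s s0; have [Ut /andP[lt0 lt] _] := lP t t0.
have [Uu _ _] := lP u u0.
have := l_mono _ _ s0 su; rewrite le_eqVlt => /orP[/eqP -> //|lsu].
have := l_mono _ _ u0 ut; rewrite le_eqVlt => /orP[/eqP -> //|lut].
case: Uu; apply: (Umax (l s) (l t)) => //; first exact: lt_trans lut.
exact: le_trans t1.
Qed.
End Prune.

(** * Injective reparametrization of monotone paths *)

Section Arcs.
Context {R : realType} {X : metricType R}.
Implicit Types (g h : R -> X) (s t u : R).

Definition arc (x y : X) g := [/\ continuous g, g 0 = x, g 1 = y
  & forall s t, 0 <= s <= 1 -> 0 <= t <= 1 -> g s = g t -> s = t].

Lemma clamp_continuous : continuous (@clamp R).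
Proof.
move=> t; apply/cvgrPdist_lt => e e0; apply/nbhs_ballP; exists e => //= s.
exact: le_lt_trans (clamp_lip t s).
Qed.

Lemma dist_path_continuous (p : X) g : continuous g ->
  continuous (fun t => Num.min 1 (mdist p (g t)) : R).
Proof.
move=> cg t; apply/cvgrPdist_lt => e e0.
have /cvg_ballP/(_ _ e0) := cg t; apply: filterS => s.
rewrite ballEmdist/= => ts.
have := metric_triangle p (g t) (g s); have := metric_triangle p (g s) (g t).
rewrite (metric_sym (g s) (g t)).
move: (mdist p (g t)) (mdist p (g s)) (mdist (g t) (g s)) ts => a b c ce ac bc.
by case: (leP 1 a) => ?; case: (leP 1 b) => ?; rewrite ltr_norml;
  apply/andP; split; lra.
Qed.

(** A continuous nondecreasing [W] with the same fibres as [h] on [[0, 1]] is built; [h] composed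
    with a rescaled section of [W] is then the arc. *)
Lemma arc_of_monotone h : continuous h -> h 0 != h 1 ->
  (forall s u t, 0 <= s -> s <= u -> u <= t -> t <= 1 -> h s = h t ->
     h u = h s) ->
  exists2 g, arc (h 0) (h 1) g & forall t, exists2 u, 0 <= u <= 1 & g t = h u.
Proof.
move=> ch h01 hmono.
have cmax q : continuous (fun u => Num.max u q : R).
  move=> t; apply/cvgrPdist_lt => e e0; apply/nbhs_ballP; exists e => //= s.
  rewrite /ball/=; case: (leP t q) => ?; case: (leP s q) => ?;
    rewrite !ltr_norml => /andP[? ?]; apply/andP; split; lra.
(* Zero up to [q], then the distance from [h q], truncated at 1 to make the weighted series
   converge. Running maxima make it nondecreasing, and rational [q] suffice to tell [h s] from
   [h t]. *)
pose phi q u : R := Num.min 1 (mdist (h q) (h (Num.max u q))).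
have cphi q : continuous (phi q).
  apply: dist_path_continuous => t.
  by apply: (@continuous_comp _ _ _ (fun u => Num.max u q) h); [exact: cmax|exact: ch].
have phi01 q u : 0 <= phi q u <= 1.
  by rewrite /phi le_min ler01 mdist_ge0 ge_min lexx.
have {cphi} [m mP] := choice (fun q => running_max (cphi q)).
pose Q n : R := if unpickle n is Some r then ratr (r : rat) else 0.
pose w n t := m (Q n) (clamp t).
have cw n : continuous (w n).
  move=> t; have [cm _ _] := mP (Q n).
  by apply: (@continuous_comp _ _ _ (@clamp R) (m (Q n)));
    [exact: clamp_continuous|exact: cm].
have w01 n t : 0 <= w n t <= 1.
  have [_ _ /(_ _ (clamp_itv t))[u _]] := mP (Q n).
  by rewrite /w => ->.
have wmono n s t : 0 <= s -> s <= t -> t <= 1 -> w n s <= w n t.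
  move=> s0 st t1; rewrite /w !clamp_id ?s0 ?t1 ?andbT; [|by lra..].
  have [_ mub mex] := mP (Q n).
  have [|u /andP[u0 us] ->] := mex s; first by rewrite s0 (le_trans st).
  by apply: mub; rewrite ?u0 ?t1 ?(le_trans us st)// andbT (le_trans s0 st).
have wneq s t : 0 <= s -> s <= t -> t <= 1 -> h s <> h t ->
    exists n, w n s < w n t.
  move=> s0 st t1 hst.
  have {}st : s < t.
    by move: st; rewrite le_eqVlt => /orP[/eqP sE|//]; case: hst; rewrite sE.
  have d0 : 0 < mdist (h s) (h t) by rewrite mdist_gt0; exact/eqP.
  have /cvg_ballP/(_ _ d0)/nbhs_ballP[d /= dpos dP] := ch s.
  (* A rational [r] just after [s] has [h r] closer to [h s] than [h t] is, so [h r <> h t]: the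
     running maximum of [phi r] is 0 at [s] and positive at [t]. *)
  have [r] : exists r : rat, s < ratr r < Num.min t (s + d).
    have /rat_in_itvoo[r] : s < Num.min t (s + d) by rewrite lt_min st ltrDl.
    by rewrite in_itv/= => ?; exists r.
  rewrite lt_min => /and3P[sr rt rd].
  exists (pickle r); rewrite /w /Q pickleK !clamp_id ?s0 ?t1 ?andbT; [|by lra..].
  have [_ mub mex] := mP (ratr r).
  have [|u /andP[u0 us] ->] := mex s; first by rewrite s0; lra.
  apply: (@lt_le_trans _ _ (phi (ratr r) t)); last first.
    by apply: mub; rewrite ?lexx ?t1 ?andbT; lra.
  rewrite /phi max_r ?(le_trans us (ltW sr))// mdistxx max_l ?(ltW rt)//.
  rewrite [X in X < _](_ : _ = 0); last by rewrite min_r.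
  rewrite lt_min ltr01 mdist_gt0; apply/eqP => hrt.
  have : ball (h s) (mdist (h s) (h t)) (h (ratr r)).
    by apply: dP; rewrite /ball/= ltr_norml; apply/andP; split; lra.
  by rewrite hrt ballEmdist/= ltxx.
have weq n s t : 0 <= s -> s <= t -> t <= 1 -> h s = h t -> w n t <= w n s.
  move=> s0 st t1 hst; rewrite /w !clamp_id ?s0 ?t1 ?andbT; [|by lra..].
  have [_ mub mex] := mP (Q n).
  have [|u /andP[u0 ut] ->] := mex t; first by rewrite (le_trans s0 st).
  have hv v : s <= v -> v <= t -> h v = h s by move=> sv vt; exact: (hmono s v t).
  have [us|su] := leP u s; first by apply: mub; rewrite ?s0 ?u0//; lra.
  apply: (@le_trans _ _ (phi (Q n) s)); last by apply: mub; rewrite ?s0 ?lexx//; lra.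
  rewrite /phi; case: (leP s (Q n)) => sQ.
    rewrite mdistxx; case: (leP u (Q n)) => uQ; first by rewrite mdistxx.
    rewrite (hv u (ltW su) ut) -(hv (Q n)) ?mdistxx//.
    exact: le_trans (ltW uQ) ut.
  by rewrite max_l ?(hv u (ltW su) ut)// ltW// (lt_trans sQ).
(* [W] is nondecreasing and identifies exactly the parameters that [h]
   identifies, so [h] factors injectively through [W]. *)
have [W [cW WP]] := weighted_sum cw w01.
have Wle s t : 0 <= s -> s <= t -> t <= 1 -> W s <= W t.
  by move=> s0 st t1; apply: (WP s t _).1 => n; exact: wmono.
have Winj s t : 0 <= s <= 1 -> 0 <= t <= 1 -> W s = W t -> h s = h t.
  wlog st : s t / s <= t.
    move=> H s01 t01 Wst; have [/H|/ltW/H] := leP s t; first exact.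
    by move=> ->.
  move=> /andP[s0 s1] /andP[t0 t1] Wst; apply: contrapT => hst.
  have : W s < W t by apply: (WP s t _).2 => [n|]; [exact: wmono|exact: wneq].
  by rewrite Wst ltxx.
have Weq s t : 0 <= s <= 1 -> 0 <= t <= 1 -> h s = h t -> W s = W t.
  wlog st : s t / s <= t.
    move=> H s01 t01 Wst; have [/H|/ltW/H] := leP s t; first exact.
    by move=> ->.
  move=> /andP[s0 s1] /andP[t0 t1] hst; apply/eqP; rewrite eq_le Wle//=.
  by apply: (WP t s _).1 => n; exact: weq.
have W01 : W 0 < W 1.
  rewrite lt_neqAle Wle// andbT; apply: contra h01 => /eqP/Winj -> //;
    by rewrite ?lexx ?ler01.
pose V u := W 0 + clamp u * (W 1 - W 0).
have ex u : exists t, 0 <= t <= 1 /\ W t = V u.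
  have [] := @IVT R W 0 1 (V u) ler01 (continuous_subspaceT cW).
    rewrite (min_l (ltW W01)) (max_r (ltW W01)) /V; have := clamp_itv u.
    by move: (clamp u) => c /andP[? ?]; apply/andP; split; nra.
  by move=> t; rewrite in_itv/= => ? ?; exists t.
have {ex} [tau tauP] := choice ex.
have Vinj s t : 0 <= s <= 1 -> 0 <= t <= 1 -> V s = V t -> s = t.
  move=> s01 t01; rewrite /V !clamp_id// => /addrI/mulIf; apply.
  by rewrite subr_eq0 gt_eqF.
have cV : continuous V.
  move=> t; apply: cvgD; first exact: cvg_cst.
  by apply: cvgMr_tmp; exact: clamp_continuous.
exists (h \o tau); last by move=> t; have [? _] := tauP t; exists (tau t).
have h0 : 0 <= (0 : R) <= 1 by rewrite lexx ler01.
have h1 : 0 <= (1 : R) <= 1 by rewrite lexx ler01.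
split.
- move=> u; apply/cvg_ballP => e e0.
  (* The section [tau] may jump, but the image under [W] of the parameters where [h] is [e]-far from
     [h (tau u)] is compact and misses [V u], hence misses [V v] for [v] near [u]. *)
  pose C := `[0, 1] `&` [set t | e <= mdist (h (tau u)) (h t)].
  have clC : closed [set t | e <= mdist (h (tau u)) (h t)].
    rewrite -[X in closed X]setCK; apply: open_closedC.
    rewrite openE => t /= /negP; rewrite -ltNge => te.
    have de : 0 < e - mdist (h (tau u)) (h t) by rewrite subr_gt0.
    have /cvg_ballP/(_ _ de) := ch t; apply: filterS => s.
    rewrite ballEmdist/= => ts; apply/negP; rewrite -ltNge.
    by apply: le_lt_trans (metric_triangle _ (h t) _) _; rewrite addrC -ltrBrDr.
  have cptC : compact C by apply: compact_closedI => //; exact: segment_compact.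
  have clWC : closed (W @` C).
    apply: compact_closed; first exact: order_hausdorff.
    by apply: continuous_compact => //; exact: continuous_subspaceT.
  have nWC : (~` (W @` C)) (V u).
    move=> [t [t01 /= et] Wt].
    have : h t = h (tau u).
      by have [? WV] := tauP u; apply: Winj; rewrite ?WV.
    by move=> ht; move: et; rewrite ht mdistxx leNgt e0.
  have : nbhs u (V @^-1` (~` (W @` C))).
    by apply: (cV u); apply: open_nbhs_nbhs; split => //; exact: closed_openC.
  apply: filterS => v /= nC; rewrite ballEmdist/= ltNge.
  apply/negP => ev; apply: nC; have [tv WV] := tauP v.
  by exists (tau v).
- have [t01 WV] := tauP 0; apply: (Winj _ _ t01 h0).
  by rewrite WV /V clamp_id// mul0r addr0.
- have [t01 WV] := tauP 1; apply: (Winj _ _ t01 h1).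
  by rewrite WV /V clamp_id// mul1r addrC subrK.
- move=> s t s01 t01 /= hst; apply: Vinj => //.
  by have [? <-] := tauP s; have [? <-] := tauP t; exact: Weq.
Qed.

Lemma arc_in_open U x y : locally_connected X -> compact [set: X] ->
  open U -> connected U -> U x -> U y -> x != y ->
  exists2 g, arc x y g & forall t, U (g t).
Proof.
move=> lcX cptX oU cU Ux Uy xy.
have [g [cg g0 g1 gU]] := path_exists lcX cptX oU cU Ux Uy.
have [h [ch h0 h1 hg hmono]] := monotone_path cg.
have [|a] := arc_of_monotone ch _ hmono; first by rewrite h0 h1 g0 g1.
rewrite h0 h1 g0 g1 => arca ah; exists a => // t.
by have [u _ ->] := ah t; have [v _ ->] := hg u.
Qed.
End Arcs.

(** * Unique arcwise connectedness of dendrites *)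

Section Curves.
Context {R : realType}.

Lemma embedding_homeomorphic (Y X : topologicalType) (S : set Y) (k : Y -> X) :
  hausdorff_space X -> compact S -> {within S, continuous k} ->
  (forall y z, S y -> S z -> k y = k z -> y = z) ->
  homeomorphic (set_type (k @` S)) (set_type S).
Proof.
move=> hX cS ck kinj.
have gP (y : set_type S) : k (val y) \in k @` S.
  by rewrite inE; exists (val y) => //; exact: set_valP.
pose g (y : set_type S) : set_type (k @` S) :=
  exist (fun x => x \in k @` S) _ (gP y).
have hex (x : set_type (k @` S)) : exists y : set_type S, k (val y) = val x.
  have [y Sy kx] := set_valP x.
  by exists (exist (fun y => y \in S) y (mem_set Sy)).
have [h hP] := choice hex.
exists h, g; split.
- by move=> x; apply/val_inj; exact: hP.
- move=> y; apply/val_inj; apply: kinj; [exact: set_valP|exact: set_valP|].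
  exact: hP.
- apply/continuousP => U [] O oO <-.
  have cK : compact (k @` (S `&` ~` O)).
    apply: continuous_compact; last by apply: compact_closedI => //; exact: open_closedC.
    by apply: continuous_subspaceW ck; exact: subIsetl.
  exists (~` (k @` (S `&` ~` O))).
    by apply: closed_openC; exact: compact_closed.
  apply/seteqP; split => x /=.
    move=> nK; apply: contrapT => nO; apply: nK; exists (val (h x)).
      by split => //; exact: set_valP.
    exact: hP.
  move=> Ox [y [Sy nO] kyx]; apply: nO.
  suff -> : y = val (h x) by [].
  by apply: kinj => //; [exact: set_valP|rewrite hP].
- apply/continuousP => U [] O oO <-.
  have /subspace_sigL_continuousP/continuousP/(_ _ oO) := ck.
  by [].
Qed.

Lemma unit_circle_closed : closed (@unit_circle R).
Proof.
rewrite (_ : unit_circle (R := R) =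
  (fun p : R * R => p.1 ^+ 2 + p.2 ^+ 2) @^-1` [set 1]) //.
apply: closed_comp; last exact: closed_eq.
move=> p _; apply: cvgD; rewrite !expr2; apply: cvgM;
  by [exact: cvg_fst|exact: cvg_snd].
Qed.

Lemma unit_circle_compact : compact (@unit_circle R).
Proof.
have -> : @unit_circle R = (`[-1, 1] `*` `[-1, 1]) `&` @unit_circle R.
  apply/seteqP; split => [p pS|p []//]; split => //.
  move: pS; rewrite /unit_circle/= => pS; split => /=; rewrite in_itv/=;
    apply/andP; split; nra.
apply: compact_closedI unit_circle_closed.
by apply: compact_setX; exact: segment_compact.
Qed.

Context {X : metricType R}.
Implicit Types (a b g : R -> X) (s t u : R).

Lemma theta_curve x y a b : arc x y a -> arc x y b ->
  (forall s t, 0 < s < 1 -> 0 <= t <= 1 -> a s <> b t) ->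
  exists C : set X, is_simple_closed_curve R C.
Proof.
move=> [ca a0 a1 ainj] [cb b0 b1 binj] ab.
(* The upper half of the circle runs along [a] and the lower half along [b], with the abscissa
   rescaled from [[-1, 1]] as parameter; the halves agree at the two points with [p.2 = 0]. *)
pose k (p : R * R) : X :=
  if 0 <= p.2 then a ((p.1 + 1) / 2) else b ((p.1 + 1) / 2).
have m01 (p : R * R) : unit_circle p -> 0 <= (p.1 + 1) / 2 <= 1.
  by rewrite /unit_circle/= => pS; apply/andP; split; nra.
have pm1 (p : R * R) : unit_circle p -> p.2 = 0 -> p.1 = 1 \/ p.1 = -1.
  rewrite /unit_circle/= => + p20; rewrite p20 expr0n/= addr0.
  by move=> /eqP; rewrite sqrf_eq1 => /orP[/eqP ->|/eqP ->]; [left|right].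
have a1b (p : R * R) : unit_circle p -> p.2 = 0 -> a ((p.1 + 1) / 2) = b ((p.1 + 1) / 2).
  move=> pS p20; have [->|->] := pm1 p pS p20.
    by rewrite -[1 + 1]/(2%:R) divff// a1 b1.
  by rewrite addNr mul0r a0 b0.
have kb (p : R * R) : unit_circle p -> p.2 <= 0 -> k p = b ((p.1 + 1) / 2).
  rewrite /k => pS p20; case: ifP => // p20'; apply: a1b => //.
  by apply/eqP; rewrite eq_le p20.
have cm : continuous (fun p : R * R => (p.1 + 1) / 2).
  by move=> p; apply: cvgMr_tmp; apply: cvgD; [exact: cvg_fst|exact: cvg_cst].
exists (k @` unit_circle (R := R)); apply: embedding_homeomorphic.
- exact: metric_hausdorff.
- exact: unit_circle_compact.
- have -> : unit_circle (R := R) = (unit_circle (R := R) `&` [set p | 0 <= p.2])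
      `|` (unit_circle (R := R) `&` [set p | p.2 <= 0]).
    apply/seteqP; split => p; last by case=> -[].
    by move=> pS; have [?|/ltW ?] := leP 0 p.2; [left|right].
  have clS := unit_circle_closed.
  apply: withinU_continuous.
  + apply: closedI => //; apply: (@closed_comp _ _ snd [set t : R | 0 <= t]).
      by move=> p _; exact: cvg_snd.
    exact: closed_ge.
  + apply: closedI => //; apply: (@closed_comp _ _ snd [set t : R | t <= 0]).
      by move=> p _; exact: cvg_snd.
    exact: closed_le.
  + apply: (@subspace_eq_continuous _ _ _ (fun p : R * R => a ((p.1 + 1) / 2))).
      by move=> p; rewrite inE => -[_ /= p2]; rewrite [RHS](_ : _ = k p)// /k p2.
    apply: continuous_subspaceT => p.
    by apply: (@continuous_comp _ _ _ (fun p : R * R => (p.1 + 1) / 2) a);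
      [exact: cm|exact: ca].
  + apply: (@subspace_eq_continuous _ _ _ (fun p : R * R => b ((p.1 + 1) / 2))).
      by move=> p; rewrite inE => -[pS /= p2]; rewrite [RHS](_ : _ = k p)// kb.
    apply: continuous_subspaceT => p.
    by apply: (@continuous_comp _ _ _ (fun p : R * R => (p.1 + 1) / 2) b);
      [exact: cm|exact: cb].
- have half (p q : R * R) : (p.1 + 1) / 2 = (q.1 + 1) / 2 :> R -> p.1 = q.1.
    by move=> ?; lra.
  have sgn (p q : R * R) : unit_circle p -> unit_circle q -> p.1 = q.1 ->
      0 <= p.2 * q.2 -> p = q :> R * R.
    case: p => p1 p2; case: q => q1 q2; rewrite /unit_circle/= => pS qS pq pq2.
    congr pair => //; subst q1; have /eqP : p2 ^+ 2 = q2 ^+ 2 by lra.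
    rewrite eqf_sqr => /orP[/eqP//|/eqP pq]; move: pq2; rewrite pq.
    rewrite mulNr oppr_ge0 -expr2 -[_ <= 0]andbT -(sqr_ge0 q2) -eq_le sqrf_eq0.
    by move=> /eqP ->; rewrite oppr0.
  have mixed (p q : R * R) : unit_circle p -> unit_circle q -> 0 <= p.2 -> q.2 < 0 ->
      a ((p.1 + 1) / 2) = b ((q.1 + 1) / 2) -> p = q.
    move=> pS qS p2 q2 apq; exfalso.
    have [p20|/eqP p20] := eqVneq p.2 0.
      rewrite a1b// in apq; have pq := half _ _ (binj _ _ (m01 _ pS) (m01 _ qS) apq).
      by move: pS qS; rewrite /unit_circle/= pq p20; nra.
    apply: ab apq; last exact: m01.
    have {}p2 : 0 < p.2 by rewrite lt_def p2 andbT; exact/eqP.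
    by move: pS; rewrite /unit_circle/= => pS; apply/andP; split; nra.
  move=> p q pS qS; rewrite /k; case: leP => p2; case: leP => q2 kpq.
  + apply: sgn => //; first by apply/half/ainj => //; exact: m01.
    exact: mulr_ge0.
  + exact: mixed.
  + by apply/esym/mixed.
  + apply: sgn => //; first by apply/half/binj => //; exact: m01.
    by rewrite ltW// nmulr_rgt0.
Qed.

Lemma arc_neq x y g : arc x y g -> x != y.
Proof.
move=> [_ <- <- ginj]; apply/eqP => /ginj; rewrite !lexx ler01.
by move=> /(_ isT isT)/eqP; rewrite eq_sym oner_eq0.
Qed.

Lemma subarc x y g s t : arc x y g -> 0 <= s <= 1 -> 0 <= t <= 1 -> s <> t ->
  arc (g s) (g t) (fun u => g (s + u * (t - s))).
Proof.
move=> [cg g0 g1 ginj] /andP[s0 s1] /andP[t0 t1] st; split.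
- move=> u; apply: (@continuous_comp _ _ _ (fun u => s + u * (t - s)) g).
    by apply: cvgD; [exact: cvg_cst|apply: cvgMr_tmp].
  exact: cg.
- by rewrite mul0r addr0.
- by rewrite mul1r addrC subrK.
- move=> u v /andP[u0 u1] /andP[v0 v1] /ginj uv; have : (u - v) * (t - s) = 0.
    by have := uv _ _; nra.
  by move=> /eqP; rewrite mulf_eq0 !subr_eq0 => /orP[/eqP//|/eqP/esym].
Qed.

Lemma arc_rev (x y : X) (g : R -> X) : arc x y g -> arc y x (fun t => g (1 - t)).
Proof.
move=> ag; have [_ g0 g1 _] := ag; rewrite -g0 -g1.
have -> : (fun t => g (1 - t)) = (fun t => g (1 + t * (0 - 1))).
  by apply/funext => t; congr g; ring.
apply: (subarc ag); rewrite ?lexx ?ler01//.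
by apply/eqP; rewrite oner_eq0.
Qed.

(** Otherwise the piece of [a] between its last contact with [b] before [t] and its first contact
    after [t], together with the piece of [b] between these contacts, forms a simple closed
    curve. *)
Lemma arc_sub_arc x y a b t : (~ exists C : set X, is_simple_closed_curve R C) ->
  arc x y a -> arc x y b -> 0 <= t <= 1 -> exists2 s, 0 <= s <= 1 & a t = b s.
Proof.
move=> noC aa ab t01; have [ca a0 a1 ainj] := aa; have [cb b0 b1 binj] := ab.
apply: contrapT => nt; pose B := b @` `[0, 1].
have clB : closed (a @^-1` B).
  apply: closed_comp => [u _|]; first exact: ca.
  apply: compact_closed; first exact: metric_hausdorff.
  apply: continuous_compact; first exact: continuous_subspaceT.
  exact: segment_compact.
have B0 : B (a 0) by rewrite a0 -b0; exists 0 => //=; rewrite in_itv/= lexx ler01.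
have B1 : B (a 1) by rewrite a1 -b1; exists 1 => //=; rewrite in_itv/= lexx ler01.
have nBt : ~ B (a t).
  by move=> [s]; rewrite /= in_itv/= => s01 bs; apply: nt; exists s.
have /andP[t0 t1] := t01.
have [s1 [Bs1 /andP[s10 s1t] s1max]] := last_point clB B0 t0.
have [s2 [Bs2 /andP[ts2 s21] s2min]] := first_point clB B1 t1.
have [u1 + bu1] := Bs1; have [u2 + bu2] := Bs2.
rewrite /= !in_itv/= => /andP[u20 u21] /andP[u10 u11].
have {}s1t : s1 < t.
  by rewrite lt_neqAle s1t andbT; apply/eqP => s1E; apply: nBt; rewrite -s1E.
have {}ts2 : t < s2.
  by rewrite lt_neqAle ts2 andbT; apply/eqP => s2E; apply: nBt; rewrite s2E.
have s12 : s1 <> s2 by lra.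
have u12 : u1 <> u2.
  move=> uE; apply: s12; apply: ainj; rewrite -?bu1 -?bu2 ?uE//; lra.
have sa : arc (a s1) (a s2) (fun u => a (s1 + u * (s2 - s1))).
  by apply: (subarc aa) => //; apply/andP; split; lra.
have sb : arc (b u1) (b u2) (fun u => b (u1 + u * (u2 - u1))).
  by apply: (subarc ab) => //; apply/andP; split; lra.
rewrite bu1 bu2 in sb; apply: noC; apply: (theta_curve sa sb).
move=> u v /andP[u0 u1'] /andP[v0 v1] abuv.
set w := s1 + u * (s2 - s1) in abuv.
have wB : B (a w).
  rewrite abuv; exists (u1 + v * (u2 - u1)) => //=; rewrite in_itv/=.
  by apply/andP; split; nra.
have [ws1 ws2] : s1 < w /\ w < s2 by rewrite /w; split; nra.
have [wt|tw] := leP w t; first exact: (s1max w).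
by apply: (s2min w) => //; exact: ltW.
Qed.

Lemma open_component (A : set X) x : locally_connected X -> open A ->
  open (connected_component A x).
Proof.
move=> lcX oA; rewrite openE => p Cp.
have Ap := connected_component_sub Cp.
have [V [oV cV Vp VA]] := lcX p A (open_nbhs_nbhs (conj oA Ap)).
apply: (filterS _ (open_nbhs_nbhs (conj oV Vp))).
by rewrite (same_connected_component Cp); exact: connected_component_max.
Qed.

(** If [C] missed [g t], it would lie in one component of the complement of [g t]; this component is
    open and connected, so it contains an arc from [x] to [y], which must pass through [g t]. *)
Lemma connected_arc x y g (C : set X) t : dendrite X -> arc x y g ->
  connected C -> C x -> C y -> 0 <= t <= 1 -> C (g t).
Proof.
move=> [[X0 cptX cX] lcX noC] ag cC Cx Cy t01; apply: contrapT => Ct.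
pose A := ~` [set g t].
have oA : open A.
  apply: closed_openC; apply: accessible_closed_set1.
  by apply: hausdorff_accessible; exact: metric_hausdorff.
have CA : C `<=` A by move=> z Cz zt; apply: Ct; rewrite -zt.
have xy := arc_neq ag.
have [] := @arc_in_open _ _ (connected_component A x) x y lcX cptX.
- exact: open_component.
- exact: component_connected.
- by apply: connected_component_refl; exact: CA.
- by apply: (connected_component_max Cx CA).
- by [].
move=> b ab bA; have [s _ gs] := arc_sub_arc noC ag ab t01.
by apply: (connected_component_sub (bA s)).
Qed.
End Curves.

(** * Fixed points in dendrites *)

Section Separation.
Context {R : realType} {X : metricType R}.
Hypothesis dX : dendrite X.
Implicit Types (a b p q x y z : X) (C : set X).

(* In a dendrite, [sep z a b] says that [z] lies on the arc from [a] to [b];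
   [fun z b => sep z a b] is the partial order of the tree rooted at [a]. *)
Definition sep z a b := forall C, connected C -> C a -> C b -> C z.

Lemma nsepP z a b : ~ sep z a b -> exists C, [/\ connected C, C a, C b & ~ C z].
Proof.
move=> nz; apply: contrapT => nC; apply: nz => C cC Ca Cb.
by apply: contrapT => Cz; apply: nC; exists C.
Qed.

Lemma nsep_trans z a b c : ~ sep z a b -> ~ sep z b c -> ~ sep z a c.
Proof.
move=> /nsepP[C [cC Ca Cb Cz]] /nsepP[D [cD Db Dc Dz]] /(_ (C `|` D)) [].
- by apply: connectedU => //; exists b.
- by left.
- by right.
- exact: Cz.
- exact: Dz.
Qed.

Lemma sep_trans x y z q : sep x q y -> sep y q z -> sep x q z.
Proof. by move=> xy yz C cC Cq Cz; apply: xy => //; apply: yz. Qed.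

Lemma arc_exists x y : x != y -> exists g, arc x y g.
Proof.
have [[_ cptX cX] lcX _] := dX => xy.
by have [g ag _] := arc_in_open lcX cptX openT cX I I xy; exists g.
Qed.

Lemma arc_image_connected x y g s t : arc x y g -> connected (g @` `[s, t]).
Proof.
move=> [cg _ _ _]; apply: connected_continuous_connected.
  exact: segment_connected.
exact: continuous_subspaceT.
Qed.

Lemma arc_sep x y g s r t : arc x y g -> 0 <= s -> s <= r -> r <= t -> t <= 1 ->
  sep (g r) (g s) (g t).
Proof.
move=> ag s0 sr rt t1 C cC Cs Ct.
have [st|/eqP st] := eqVneq s t.
  by rewrite (_ : r = s)//; apply/eqP; rewrite eq_le sr andbT st.
have {st} st' : s < t by rewrite lt_neqAle (le_trans sr rt) andbT; apply/eqP.
have ts0 : 0 < t - s by rewrite subr_gt0.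
have sa : arc (g s) (g t) (fun u => g (s + u * (t - s))).
  by apply: (subarc ag); [apply/andP; split; lra..|lra].
have := connected_arc dX sa cC Cs Ct (t := (r - s) / (t - s)).
rewrite /= divfK ?gt_eqF// [s + _]addrC subrK; apply.
by rewrite ler_pdivlMr// ler_pdivrMr// mul0r mul1r subr_ge0 sr lerB.
Qed.

Lemma nsep_arc x y g s r t : arc x y g -> 0 <= r -> r < s -> r < t ->
  s <= 1 -> t <= 1 -> ~ sep (g r) (g s) (g t).
Proof.
move=> ag r0 rs rt s1 t1 /(_ (g @` `[Num.min s t, 1])).
have lts : Num.min s t <= s by rewrite ge_min lexx.
have ltt : Num.min s t <= t by rewrite ge_min lexx orbT.
have rm : r < Num.min s t by rewrite lt_min rs.
have [_ _ _ ginj] := ag.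
move=> []; first exact: arc_image_connected ag.
- by exists s => //=; rewrite in_itv/= lts.
- by exists t => //=; rewrite in_itv/= ltt.
move=> u; rewrite /= in_itv/= => /andP[mu u1] /ginj ur.
have : u = r by apply: ur; apply/andP; split; lra.
lra.
Qed.

(** The arc from [a] to [b] serves. Closedness lets limit arguments use its complement as a
    neighbourhood. *)
Lemma closed_connected_sub C a b : connected C -> C a -> C b ->
  exists B, [/\ closed B, connected B, B a, B b & B `<=` C].
Proof.
move=> cC Ca Cb; have [<-|/arc_exists[g ag]] := eqVneq a b.
  exists [set a]; split => //; [|exact: connected1|by move=> _ ->].
  apply: accessible_closed_set1.
  by apply: hausdorff_accessible; exact: metric_hausdorff.
have [cg g0 g1 _] := ag; exists (g @` `[0, 1]); split.
- apply: compact_closed; first exact: metric_hausdorff.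
  apply: continuous_compact; first exact: continuous_subspaceT.
  exact: segment_compact.
- exact: arc_image_connected ag.
- by exists 0 => //=; rewrite in_itv/= lexx ler01.
- by exists 1 => //=; rewrite in_itv/= lexx ler01.
- by move=> _ [t + <-]; rewrite /= in_itv/= => /(connected_arc dX ag cC Ca Cb).
Qed.

Lemma sep_anti x y q : sep x q y -> sep y q x -> x = y.
Proof.
move=> xqy yqx; have [qy|/arc_exists[g ag]] := eqVneq q y.
  by subst q; apply: (xqy [set y]) => //; exact: connected1.
have [_ g0 g1 ginj] := ag.
have [] := xqy (g @` `[0, 1]).
- exact: arc_image_connected ag.
- by exists 0 => //=; rewrite in_itv/= lexx ler01.
- by exists 1 => //=; rewrite in_itv/= lexx ler01.
move=> s; rewrite /= in_itv/= => /andP[s0 s1] gs.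
have [] := yqx (g @` `[0, s]).
- exact: arc_image_connected ag.
- by exists 0 => //=; rewrite in_itv/= lexx.
- by exists s => //=; rewrite in_itv/= lexx s0.
move=> u; rewrite /= in_itv/= => /andP[u0 us] gu.
have uE : u = 1 by apply: ginj; rewrite ?gu ?g1// ?u0 ?(le_trans us)// lexx ler01.
by rewrite -gs -g1; congr g; apply/eqP; rewrite eq_le s1 -uE.
Qed.

(** [V] is connected so that it can be glued to connected sets near [y] without picking up points
    near [x]. *)
Lemma separated_nbhs x y : x != y -> exists V W, [/\ open V, connected V,
  V y, nbhs x W & V `&` W = set0].
Proof.
have [_ lcX _] := dX => xy; pose r := mdist x y / 2.
have r0 : 0 < r by rewrite divr_gt0// mdist_gt0.
have [V [oV cV Vy VB]] := lcX _ _ (nbhsx_ballx y r r0).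
exists V, (ball x r); split => //; first exact: nbhsx_ballx.
rewrite -subset0 => z [/VB yz xz].
have := ball_triangle xz (ball_sym yz).
by rewrite -splitr ballEmdist/= ltxx.
Qed.

Section FixedPoint.
Variables (f : X -> X) (q : X).
Hypothesis cf : continuous f.

(** [x'] is slightly beyond [x] towards [f x], so close to [x] that [f x'] stays in a connected
    neighbourhood of [f x] missing [x']. *)
Lemma sep_step x : sep x q (f x) -> f x <> x -> exists x',
  [/\ x' <> x, sep x' q (f x'), sep x q x', sep x' x (f x) & ~ sep x x' (f x)].
Proof.
move=> xqf fx; have xf : x != f x by apply/eqP => /esym.
have [g ag] := arc_exists xf; have [cg g0 g1 ginj] := ag.
have [V [W [oV cV Vfx nW VW]]] := separated_nbhs xf.
have : \forall t \near (0 : R), W (g t) /\ V (f (g t)).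
  have W0 : nbhs (g 0) W by rewrite g0.
  have V0 : nbhs (f (g 0)) V by rewrite g0; exact: open_nbhs_nbhs.
  near=> t; split; near: t; first exact: cg.
  by apply: (@continuous_comp _ _ _ g f 0); [exact: cg|exact: cf|exact: V0].
move=> /nbhs_ballP[d /= d0 dP].
pose t := Num.min (d / 2) 1.
have t0 : 0 < t by rewrite lt_min divr_gt0//=.
have t1 : t <= 1 by rewrite ge_min lexx orbT.
have td : t < d by rewrite gt_min ltr_pdivrMr// ltr_pMr// ltr1n.
have [Wt Vt] : W (g t) /\ V (f (g t)).
  by apply: dP; rewrite /ball/= sub0r normrN gtr0_norm.
have nVt : ~ V (g t) by move=> Vgt; have : (V `&` W) (g t) by []; rewrite VW.
have tx : sep (g t) x (f x).
  by rewrite -{1}g0 -g1; apply: (arc_sep ag) => //; exact: ltW.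
have ntx : ~ sep x (g t) (f x).
  by rewrite -{1}g0 -g1; apply: (nsep_arc ag) => //; exact: ltr01.
exists (g t); split => //.
- move=> gtx; have : t = 0 by apply: ginj; rewrite ?g0// ?lexx ?ler01// ltW.
  by move=> tE; rewrite tE ltxx in t0.
(* A connected set joining [q] to [f x'] and avoiding [x'], extended by [V], reaches [f x]; it then
   contains [x], and therefore [x']. *)
- move=> C cC Cq Cf; apply: contrapT => Ct.
  have cCV : connected (C `|` V) by apply: connectedU => //; exists (f (g t)).
  have CVx : (C `|` V) x by apply: xqf => //; [left|right].
  by have [] : (C `|` V) (g t) by apply: tx => //; right.
- move=> C cC Cq Ct; have [D [cD Dt Df Dx]] := nsepP ntx.
  have cCD : connected (C `|` D) by apply: connectedU => //; exists (g t).
  by have [] : (C `|` D) x by apply: xqf => //; [left|right].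
Unshelve. all: by end_near.
Qed.

(** Upper bounds for Zorn's lemma: by compactness the tails of the chain have a cluster point, and
    failure of either property there would already occur at nearby points of the chain. *)
Lemma sep_chain_bound (A : set X) : A !=set0 ->
  (forall x, A x -> sep x q (f x)) ->
  (forall x y, A x -> A y -> sep x q y \/ sep y q x) ->
  exists s, sep s q (f s) /\ forall x, A x -> sep x q s.
Proof.
move=> [a Aa] Af Atot; have [[_ cptX _] lcX _] := dX.
pose G : set_system X :=
  [set Q | exists2 x, A x & forall y, A y -> sep x q y -> Q y].
have FG : ProperFilter G.
  split.
    by move=> [x Ax /(_ x Ax)]; apply => C.
  split.
  - by exists a.
  - move=> P Q [x Ax xP] [y Ay yQ]; have [xy|yx] := Atot x y Ax Ay.
      exists y => // z Az yz; split; last exact: yQ.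
      by apply: xP => //; exact: sep_trans yz.
    exists x => // z Az xz; split; first exact: xP.
    by apply: yQ => //; exact: sep_trans xz.
  - by move=> P Q PQ [x Ax xP]; exists x => // y Ay xy; apply/PQ/xP.
have [s [_ sG]] := cptX G FG filterT.
exists s; split; last first.
  move=> x Ax C cC Cq Cs; apply: contrapT => Cx.
  have xs : x != s by apply/eqP => xs; apply: Cx; rewrite xs.
  have [V [W [oV cV Vs nW VW]]] := separated_nbhs xs.
  have [y [[Ay xy] Vy]] : ([set y | A y /\ sep x q y] `&` V) !=set0.
    by apply: sG; [exists x|exact: open_nbhs_nbhs].
  have [//|Vx] : (C `|` V) x.
    apply: xy; [|by left|by right].
    by apply: connectedU => //; exists s.
  have : (V `&` W) x by split => //; exact: nbhs_singleton.
  by rewrite VW.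
move=> C cC Cq Cfs; apply: contrapT => Cs.
have [B [clB cB Bq Bfs BC]] := closed_connected_sub cC Cq Cfs.
have sfs : s != f s by apply/eqP => sfs; apply: Cs; rewrite sfs.
have [V [W [oV cV Vfs nW VW]]] := separated_nbhs sfs.
have [y [Ay [[Wy By] Vy]]] : (A `&` (W `&` ~` B `&` f @^-1` V)) !=set0.
  apply: sG; first by exists a.
  apply: filterI; first apply: filterI => //.
    apply: open_nbhs_nbhs; split; first exact: closed_openC.
    by move=> /BC.
  by apply: cf; exact: open_nbhs_nbhs.
have [//|Vy'] : (B `|` V) y.
  apply: Af => //; [|by left|by right].
  by apply: connectedU => //; exists (f s).
have : (V `&` W) y by [].
by rewrite VW.
Qed.

(* Points [x] on the arc from [q] to [f x] can be pushed further away from [q]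
   unless they are fixed, so a maximal one is fixed. *)
Lemma fixed_point_beyond : f q <> q -> exists2 z, f z = z & ~ sep q z (f q).
Proof.
move=> fq; have sq : sep q q (f q) by [].
have [q' [q'q q'f _ q'fq nqq']] := sep_step sq fq.
(* Restricting to points beyond the first step [q'] keeps the maximal element in the component of
   the complement of [q] that contains [f q]. *)
pose T := {x : X | sep x q (f x) /\ sep q' q x}.
pose le_q (x y : T) := `[< sep (sval x) q (sval y) >].
have [|r s t||A Atot|[m [mf q'm]] mmax] := @Zorn T le_q.
- by move=> x; apply/asboolP => C.
- by move=> /asboolP rs /asboolP st; apply/asboolP; exact: sep_trans st.
- move=> [x Px] [y Py] /asboolP/= xy /asboolP/= yx.
  have xyE := sep_anti xy yx; subst y.
  by congr exist; exact: Prop_irrelevance.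
- have [[a Aa]|A0] := pselect (A !=set0); last first.
    have Tq' : sep q' q (f q') /\ sep q' q q' by split => // C.
    by exists (exist _ q' Tq') => s As; case: A0; exists s.
  have [|x [[x' [Px Qx]] _ <-]//|x y [x' Ax <-] [y' Ay <-]|s [sf As]] :=
      @sep_chain_bound (sval @` A).
  + by exists (sval a); exists a.
  + by case: (Atot x' y' Ax Ay) => /asboolP; [left|right].
  have Ts : sep s q (f s) /\ sep q' q s.
    split => //; apply: (@sep_trans _ (sval a)); first by case: (svalP a).
    by apply: As; exists a.
  by exists (exist _ s Ts) => x Ax; apply/asboolP; apply: As; exact: imageP.
have fm : f m = m.
  apply: contrapT => /(sep_step mf)[x' [x'm x'f mx' _ _]].
  have Tx' : sep x' q (f x') /\ sep q' q x' by split => //; exact: sep_trans mx'.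
  have /(congr1 sval)/=// := mmax (exist _ x' Tx') (introT (asboolP _) mx').
(* [q'] lies on the arc from [q] to [m], strictly after [q], so the portion from [q'] to [m] avoids
   [q]. *)
exists m => //; apply: (@nsep_trans _ _ q'); last exact: nqq'.
have qm : q != m.
  apply/eqP => qm; apply: q'q; apply: (q'm [set q]) => //; exact: connected1.
have [g ag] := arc_exists qm; have [_ g0 g1 ginj] := ag.
have [] := q'm (g @` `[0, 1]).
- exact: arc_image_connected ag.
- by exists 0 => //=; rewrite in_itv/= lexx ler01.
- by exists 1 => //=; rewrite in_itv/= lexx ler01.
move=> s; rewrite /= in_itv/= => /andP[s0 s1] gs.
rewrite -gs -{1}g0 -g1; apply: (nsep_arc ag) => //.
by rewrite lt_def s0 andbT; apply/eqP => sE; apply: q'q; rewrite -gs sE.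
Qed.
End FixedPoint.
End Separation.

(** * Expanding arcs and periodic points *)

Section ArcSets.
Context {R : realType} {X : metricType R}.

Lemma arc_is_arc (x y : X) (g : R -> X) : arc x y g -> is_arc R (g @` `[0, 1]).
Proof.
move=> [cg _ _ ginj]; apply: embedding_homeomorphic.
- exact: metric_hausdorff.
- exact: segment_compact.
- exact: continuous_subspaceT.
- by move=> s t; rewrite /= !in_itv/=; exact: ginj.
Qed.

Lemma is_arc_parametrized (A : set X) : is_arc R A ->
  exists x y (g : R -> X), arc x y g /\ A = g @` `[0, 1].
Proof.
move=> [h [k [hk kh ch ck]]].
have clampP (t : R) : clamp t \in (`[0, 1]%classic : set R).
  by rewrite inE /= in_itv/=; exact: clamp_itv.
pose c t : set_type (`[0, 1]%classic : set R) :=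
  exist (fun t => t \in (`[0, 1]%classic : set R)) _ (clampP t).
pose g t : X := val (k (c t)).
exists (g 0), (g 1), g; split; [split=> //|].
- have cc : continuous c.
    apply/continuousP => U [] O oO <-.
    by have /continuousP/(_ _ oO) := @clamp_continuous R.
  move=> t; apply: (@continuous_comp _ _ _ (k \o c) val).
    by apply: (@continuous_comp _ _ _ c k); [exact: cc|exact: ck].
  exact: initial_continuous.
- move=> s t s01 t01 /val_inj /(can_inj kh) /(congr1 val)/=.
  by rewrite !clamp_id.
- apply/seteqP; split => [x Ax|_ [t _ <-]]; last exact: set_valP.
  pose a : set_type A := exist (fun x => x \in A) x (mem_set Ax).
  exists (val (h a)); first exact: set_valP.
  rewrite /g (_ : c _ = h a) ?hk//; apply: val_inj => /=.
  by apply: clamp_id; have := set_valP (h a); rewrite /= in_itv.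
Qed.
End ArcSets.

Section Iterates.
Context {T : Type} (f : T -> T).

Lemma iter_mul m n x : iter (m * n) f x = iter m (iter n f) x.
Proof. by elim: m => // m IH; rewrite mulSn iterD IH. Qed.

Lemma iter_fixed m x : f x = x -> iter m f x = x.
Proof. by move=> fx; elim: m => //= m ->. Qed.

Lemma periodic_iter x n : periodic_points f x -> periodic_points f (iter n f x).
Proof.
by move=> [m m0 fx]; exists m => //; rewrite -iterD addnC iterD fx.
Qed.

(** With periods [k] and [l], the iterate of order [n * (k * l)] fixes both points and factors
    through [iter n f]. *)
Lemma periodic_injective x y n : periodic_points f x -> periodic_points f y ->
  iter n f x = iter n f y -> x = y.
Proof.
move=> [k k0 fx] [l l0 fy] xy.
have nkl : (n <= n * (k * l))%N by rewrite leq_pmulr// muln_gt0 k0.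
have fixk z m p : iter m f z = z -> iter (p * m) f z = z.
  by move=> ?; rewrite iter_mul; elim: p => //= p ->.
have <- : iter (n * (k * l)) f x = x by rewrite mulnCA mulnC; exact: fixk.
have <- : iter (n * (k * l)) f y = y by rewrite mulnA; exact: fixk.
by rewrite -(subnK nkl) !iterD xy.
Qed.
End Iterates.

Section Dendrite.
Context {R : realType} {X : metricType R}.
Hypothesis dX : dendrite X.
Variable f : X -> X.
Hypothesis cf : continuous f.
Local Notation P := (periodic_points f).

Lemma iter_continuous n : continuous (iter n f).
Proof.
elim: n => [|n IH] x; first exact: cvg_id.
by apply: (@continuous_comp _ _ _ (iter n f) f); [exact: IH|exact: cf].
Qed.

(** * From the absence of expanding arcs to connectedness of the periodic set *)

Section NoExpandingArc.
Hypothesis noexp : ~ exists A : set X, is_arc R A /\ expanding f A.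

(** The image of the arc from [x] to [g t] is connected and contains [x] and [g s], hence the longer
    arc from [x] to [g s]: the shorter arc would be expanding. *)
Lemma no_outward_motion (x y : X) (g : R -> X) n s t : arc x y g -> (0 < n)%N ->
  iter n f x = x -> 0 < t -> t < s -> s <= 1 -> iter n f (g t) = g s -> False.
Proof.
move=> ag n0 fx t0 ts s1 ft; have [cg g0 g1 ginj] := ag.
have a' : arc (g 0) (g t) (fun u => g (0 + u * (t - 0))).
  apply: (subarc ag); [by rewrite lexx ler01|apply/andP; split; lra|lra].
have Au u : 0 <= u <= t ->
    ((fun u => g (0 + u * (t - 0))) @` `[0, 1]) (g u).
  move=> /andP[u0 ut]; exists (u / t); last by rewrite subr0 add0r divfK// gt_eqF.
  by rewrite /= in_itv/= ler_pdivrMr// mul1r ut divr_ge0// ltW.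
apply: noexp; eexists; split; first exact: arc_is_arc a'.
set A := _ @` _ in Au *; exists n => //.
have cA : connected (iter n f @` A).
  apply: connected_continuous_connected; first exact: arc_image_connected a'.
  exact/continuous_subspaceT/iter_continuous.
split.
  move=> _ [u + <-]; rewrite /= in_itv/= subr0 add0r => /andP[u0 u1].
  have ut0 : 0 <= u * t by rewrite mulr_ge0// ltW.
  have uts : u * t <= s by apply: le_trans (ltW ts); rewrite ler_piMl// ltW.
  apply: (arc_sep dX ag (lexx 0) ut0 uts s1 cA).
  - by exists (g 0); [apply: Au; rewrite lexx ltW|rewrite g0].
  - by exists (g t) => //; apply: Au; rewrite lexx ltW.
move=> /(_ (g s))[].
  by exists (g t) => //; apply: Au; rewrite lexx ltW.
move=> u; rewrite /= in_itv/= subr0 add0r => /andP[u0 u1] /ginj us.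
have : u * t = s by apply: us; apply/andP; split; nra.
nra.
Qed.

Lemma periodic_arc (x y : X) (g : R -> X) t : arc x y g -> P x -> P y ->
  0 <= t <= 1 -> P (g t).
Proof.
move=> ag Px Py t01; apply: contrapT => nPt.
have [k k0 fx] := Px; have [l l0 fy] := Py.
pose n := (k * l)%N.
have n0 : (0 < n)%N by rewrite muln_gt0 k0.
have nx : iter n f x = x by rewrite /n mulnC iter_mul iter_fixed.
have ny : iter n f y = y by rewrite /n iter_mul iter_fixed.
have [cg g0 g1 ginj] := ag.
pose B := g @` `[0, 1].
have B0 : B x by exists 0 => //=; rewrite in_itv/= lexx ler01.
have B1 : B y by exists 1 => //=; rewrite in_itv/= lexx ler01.
have cB : connected (iter n f @` B).
  apply: connected_continuous_connected; first exact: arc_image_connected ag.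
  exact/continuous_subspaceT/iter_continuous.
have BfB : B `<=` iter n f @` B.
  move=> _ [u + <-]; rewrite /= in_itv/= => u01.
  by apply: (connected_arc dX ag cB) => //; [exists x|exists y].
have fBB : iter n f @` B `<=` B.
  apply: contrapT => nfB; apply: noexp; exists B; split.
    exact: arc_is_arc ag.
  by exists n.
have [s + gs] : B (iter n f (g t)).
  by apply: fBB; exists (g t) => //; exists t => //=; rewrite in_itv.
rewrite /= in_itv/= => /andP[s0 s1]; have /andP[t0 t1] := t01.
have {}t0 : 0 < t.
  by rewrite lt_def t0 andbT; apply/eqP => tE; apply: nPt; rewrite tE g0.
have {}t1 : t < 1.
  by rewrite lt_def t1 andbT; apply/eqP => tE; apply: nPt; rewrite -tE g1.
(* Motion towards [y] is outward seen from the fixed point [x]; motion towards [x] is outward from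
   [y] on the reversed arc. *)
have [st|ts|st] := ltgtP s t.
- apply: (no_outward_motion (arc_rev ag) n0 ny (t := 1 - t) (s := 1 - s));
    rewrite ?subKr//; lra.
- exact: (no_outward_motion ag n0 nx t0 ts).
- by apply: nPt; exists n => //; rewrite -gs st.
Qed.

Lemma periodic_connected : connected P.
Proof.
have [[x Px]|nP] := pselect (P !=set0); last first.
  rewrite (_ : P = set0); first exact: connected0.
  by rewrite -subset0 => x Px; apply: nP; exists x.
suff <- : connected_component P x = P by exact: component_connected.
apply/seteqP; split; first exact: connected_component_sub.
move=> y Py; have [<-|/(arc_exists dX)[g ag]] := eqVneq x y.
  exact: connected_component_refl.
have [_ g0 g1 _] := ag.
apply: (@connected_component_max _ P (g @` `[0, 1])).
- by exists 0 => //=; rewrite in_itv/= lexx ler01.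
- by move=> _ [t + <-]; rewrite /= in_itv/= => /(periodic_arc ag Px Py).
- exact: arc_image_connected ag.
- by exists 1 => //=; rewrite in_itv/= lexx ler01.
Qed.
End NoExpandingArc.

(** * From connectedness of the periodic set to the absence of expanding arcs *)

Section ConnectedPeriodic.
Hypothesis cP : connected P.

(** [iter m f] has a fixed point on the side of [q] that contains the image of [q]; this fixed point
    and [p] are joined by [P], which avoids [q]. *)
Lemma orbit_side q p m : ~ P q -> (0 < m)%N -> P p -> ~ sep q p (iter m f q).
Proof.
move=> nPq m0 Pp.
have fq : iter m f q <> q by move=> fq; apply: nPq; exists m.
have [z fz] := fixed_point_beyond dX (@iter_continuous m) fq.
apply: nsep_trans => /(_ P cP Pp) Pq; apply: nPq; apply: Pq.
by exists m.
Qed.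

Lemma backward_orbit (T : Type) (g : T -> T) (A : set T) (a : T) :
  A a -> A `<=` g @` A ->
  exists u : nat -> T, [/\ u 0%N = a, forall n, A (u n) & forall n, g (u n.+1) = u n].
Proof.
move=> Aa AgA.
have ex x : exists y, A x -> A y /\ g y = x.
  have [Ax|nAx] := pselect (A x); last by exists x.
  by have [y Ay gy] := AgA x Ax; exists y.
have [h hP] := choice ex.
have Au n : A (iter n h a) by elim: n => //= n /hP[].
by exists (fun n => iter n h a); split => // n; have [] := hP _ (Au n).
Qed.

(* A backward orbit of the endpoint [x] inside the arc must move monotonically
   away from [x], because every non-periodic point has its whole forward orbit
   on the side of the periodic set; its limit is fixed and lies on the wrong
   side. *)
Lemma endpoint_periodic (x y : X) (g : R -> X) n : arc x y g -> (0 < n)%N ->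
  g @` `[0, 1] `<=` iter n f @` (g @` `[0, 1]) -> P x.
Proof.
move=> ag n0 AfA; apply: contrapT => nPx; have [cg g0 g1 ginj] := ag.
have A0 : (`[0, 1]%classic : set R) 0 by rewrite /= in_itv/= lexx ler01.
have [a [a0 aA aS]] : exists a : nat -> X,
    [/\ a 0%N = x, forall k, (g @` `[0, 1]) (a k) & forall k, iter n f (a k.+1) = a k].
  by apply: backward_orbit => //; exists 0.
have ex k : exists t, 0 <= t <= 1 /\ g t = a k.
  by have [s + gs] := aA k; rewrite /= in_itv/= => ?; exists s.
have [t tP] := choice ex.
have ax k : iter (k * n) f (a k) = x.
  by elim: k => // k IH; rewrite mulSn addnC iterD aS.
have nPa k : ~ P (a k) by move=> /(periodic_iter (k * n)); rewrite ax.
have [p fp _] := fixed_point_beyond dX cf (fun fx => nPx (ex_intro2 _ _ 1%N isT fx)).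
have Pp : P p by exists 1%N.
have sideC q z : ~ sep q p z -> ~ sep q z p by move=> h s; apply: h => C *; exact: s.
(* Both [x] and [a k] are forward iterates of [a k.+1], so both lie on the side of [a k.+1] that
   contains [p]. *)
have side k : ~ sep (a k.+1) x (a k).
  apply: (@nsep_trans _ _ _ _ p); [apply: sideC|].
    by rewrite -(ax k.+1); apply: orbit_side; rewrite ?muln_gt0.
  by rewrite -(aS k); apply: orbit_side.
have tinc k : t k < t k.+1.
  rewrite ltNge; apply/negP => tk; apply: (side k).
  have [/andP[tk0 tk1] <-] := tP k; have [/andP[tk0' _] <-] := tP k.+1.
  by rewrite -g0; exact: (arc_sep dX ag (lexx 0) tk0' tk tk1).
have thomo : {homo t : m n / (m <= n)%N >-> m <= n}.
  by apply: homo_leq => [//||k]; [exact: le_trans|exact: ltW].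
have tcvg : cvgn t.
  by apply: nondecreasing_is_cvgn => //; exists 1 => _ [k _ <-]; have [/andP[]] := tP k.
pose l := limn t.
have tl k : t k <= l by exact: nondecreasing_cvgn_le.
have l1 : l <= 1 by apply: limr_le => //; near=> k; have [/andP[]] := tP k.
have gal : a @ \oo --> g l.
  rewrite (_ : a = g \o t); last by apply/funext => k /=; have [_ ->] := tP k.
  by apply: continuous_cvg => //; exact: cg.
have fgl : iter n f (g l) = g l.
  apply: (cvg_unique (@metric_hausdorff _ X) (F := (fun k => a k) @ \oo)) => //.
  rewrite (_ : (fun k => a k) = fun k => iter n f (a k.+1)); last first.
    by apply/funext => k; rewrite aS.
  apply: continuous_cvg; first exact: iter_continuous.
  by move=> U /gal[N _ NU]; exists N => // k Nk; apply: NU; exact: leqW.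
have Pgl : P (g l) by exists n.
(* [a 1] is mapped to [x], so it cannot separate [x] from the periodic point [g l]; yet it lies on
   the arc between them. *)
have := orbit_side (nPa 1%N) n0 Pgl; rewrite aS a0; apply.
have [/andP[t10 _] <-] := tP 1%N; rewrite -g0 => C cC Cl C0.
exact: (arc_sep dX ag (lexx 0) t10 (tl 1%N) l1).
Unshelve. all: by end_near.
Qed.

Lemma no_expanding_arc : ~ exists A : set X, is_arc R A /\ expanding f A.
Proof.
move=> [A [/is_arc_parametrized[x [y [g [ag ->]]]] [n n0 [AfA nfA]]]].
have Px := endpoint_periodic ag n0 AfA.
have rev : (fun t => g (1 - t)) @` `[0, 1] = g @` `[0, 1].
  apply/seteqP; split => _ [t + <-]; rewrite /= in_itv/= => /andP[t0 t1].
    by exists (1 - t) => //=; rewrite in_itv/=; apply/andP; split; lra.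
  exists (1 - t); last by rewrite subKr.
  by rewrite /= in_itv/=; apply/andP; split; lra.
have Py : P y by apply: (endpoint_periodic (arc_rev ag) n0); rewrite rev.
set A' := g @` `[0, 1] in AfA nfA.
have [k k0 fx] := Px; have [m m0 fy] := Py.
have [N NE] : exists N, (k * m)%N = N.+1.
  by exists (k * m).-1; rewrite prednK// muln_gt0 k0.
(* The factors [k] and [m] make [h] fix both endpoints; the factor [n] makes [h] a power of
   [iter n f], along whose powers the images of [A'] increase. *)
pose h := iter (k * m * n) f.
have hx : h x = x.
  by rewrite /h -mulnA mulnC iter_mul iter_fixed// fx.
have hy : h y = y.
  by rewrite /h mulnAC mulnC mulnC iter_mul iter_fixed// fy.
have PA z : A' z -> P z.
  move=> [t + <-]; rewrite /= in_itv/= => t01.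
  exact: (connected_arc dX ag cP Px Py t01).
have [cg g0 g1 ginj] := ag.
have ah : arc x y (h \o g).
  split; rewrite /= ?g0 ?g1//.
    by move=> t; apply: (@continuous_comp _ _ _ g h);
      [exact: cg|exact: iter_continuous].
  move=> s t s01 t01 hst; apply: ginj => //; apply: (periodic_injective _ _ hst).
    by apply: PA; exists s => //=; rewrite in_itv.
  by apply: PA; exists t => //=; rewrite in_itv.
(* All points of [A'] are periodic, so [h] is injective there and [h \o g] is again an arc from [x]
   to [y]; it must lie in the connected set [A']. *)
have hA z : A' z -> A' (h z).
  move=> [t + <-]; rewrite /= in_itv/= => t01.
  apply: (connected_arc dX ah (arc_image_connected ag)) => //.
  - by exists 0 => //=; rewrite in_itv/= lexx ler01.
  - by exists 1 => //=; rewrite in_itv/= lexx ler01.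
have fAh j : iter n f @` A' `<=` iter (j.+1 * n) f @` A'.
  elim: j => [|j IH]; first by rewrite mul1n.
  move=> _ [z /AfA/IH[w Aw <-] <-]; exists w => //.
  by rewrite -iterD -mulSn.
(* The image of [A'] under [iter n f] is contained in its image under [h], hence in [A'], against
   strict expansion. *)
by apply: nfA => z /(fAh N); rewrite -NE => -[w Aw <-]; exact: hA.
Qed.
End ConnectedPeriodic.
End Dendrite.

Theorem corollary3p5 (R : realType) (X : metricType R) (f : X -> X)
    (hX : dendrite X) (hf : continuous f) :
  (~ exists A : set X, is_arc R A /\ expanding f A) <->
  connected (periodic_points f).
Proof.
split; first exact: periodic_connected.
exact: no_expanding_arc.
Qed.
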